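(* Let $N\ge 1$ and consider the Kalman filter over $N$ steps described in the context, with initial values $\hat x_{0|0}$, $P_{0|0}$, system matrices $F_n,H_n,B_n$, inputs $u_n$, noise covariance matrices $Q_n,R_n$ and measurements $y_n$ ($1\le n\le N$). Consider a scalar loss $$\mathcal L=\sum_{n=1}^N\bigl(l_{n|n}+l_{n|n-1}\bigr),$$ where $l_{n|n-1}=l_{n|n-1}(\hat x_{n|n-1},P_{n|n-1},R_n,y_n)$ and $l_{n|n}=l_{n|n}(\hat x_{n|n},P_{n|n})$ are differentiable functions. With the meaning of the derivatives $\frac{\partial\mathcal L}{\partial\,\cdot}$ fixed in the context (in particular, derivatives with respect to symmetric matrices are the symmetric gradients), the derivatives of $\mathcal L$ satisfy the following backward recursion. Initialization at $n=N$: $$\frac{\partial \mathcal L}{\partial \hat x_{N|N}}=\frac{\partial l_{N|N}}{\partial \hat x_{N|N}},\qquad \frac{\partial \mathcal L}{\partial P_{N|N}}=\frac{\partial l_{N|N}}{\partial P_{N|N}} .$$ For every $n=N,N-1,\dots,1$, the state variable equations $$\frac{\partial\mathcal L}{\partial\hat x_{n|n-1}}=(I-K_nH_n)^T\frac{\partial\mathcal L}{\partial\hat x_{n|n}}+\frac{\partial l_{n|n-1}}{\partial\hat x_{n|n-1}},$$ $$\frac{\partial\mathcal L}{\partial P_{n|n-1}}=(I-K_nH_n)^T\Bigl[\frac{\partial\mathcal L}{\partial P_{n|n}}+\frac12\frac{\partial\mathcal L}{\partial\hat x_{n|n}}z_n^TR_n^{-1}H_n+\frac12H_n^TR_n^{-1}z_n\Bigl(\frac{\partial\mathcal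 L}{\partial\hat x_{n|n}}\Bigr)^T\Bigr](I-K_nH_n)+\frac{\partial l_{n|n-1}}{\partial P_{n|n-1}},$$ $$\frac{\partial\mathcal L}{\partial\hat x_{n-1|n-1}}=F_n^T\frac{\partial\mathcal L}{\partial\hat x_{n|n-1}}+\frac{\partial l_{n-1|n-1}}{\partial\hat x_{n-1|n-1}},$$ $$\frac{\partial\mathcal L}{\partial P_{n-1|n-1}}=F_n^T\frac{\partial\mathcal L}{\partial P_{n|n-1}}F_n+\frac{\partial l_{n-1|n-1}}{\partial P_{n-1|n-1}},$$ (with the convention $l_{0|0}=0$ when $n=1$), and the parameter equations $$\frac{\partial\mathcal L}{\partial y_n}=K_n^T\frac{\partial\mathcal L}{\partial\hat x_{n|n}}+\frac{\partial l_{n|n-1}}{\partial y_n},\qquad \frac{\partial\mathcal L}{\partial Q_n}=\frac{\partial\mathcal L}{\partial P_{n|n-1}},$$ $$\frac{\partial\mathcal L}{\partial R_n}=K_n^T\frac{\partial\mathcal L}{\partial P_{n|n}}K_n-\frac12K_n^T\frac{\partial\mathcal L}{\partial\hat x_{n|n}}z_n^TS_n^{-1}-\frac12S_n^{-1}z_n\Bigl(\frac{\partial\mathcal L}{\partial\hat x_{n|n}}\Bigr)^TK_n+\frac{\partial l_{n|n-1}}{\partial R_n}$$ hold. If moreover $R_n$ is parametrized in square-root form $R_n=L_nL_n^T$, then $$\frac{\partial\mathcal L}{\partial L_n}=2\,\frac{\partial\mathcal L}{\partial R_n}L_n .$$ Finally, in the case of static noise parameters: if $R_n=R$ for all $n$,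 then $\frac{\partial\mathcal L}{\partial R}=\sum_{n=1}^N\frac{\partial\mathcal L}{\partial R_n}$; likewise, if $Q_n=Q$ for all $n$, then $\frac{\partial\mathcal L}{\partial Q}=\sum_{n=1}^N\frac{\partial\mathcal L}{\partial Q_n}$.
   Context: **Kalman filter.** All vectors and matrices are real and of compatible sizes. $P_{0|0}$ and $Q_n$ are covariance matrices (symmetric positive semidefinite) and $R_n$ is symmetric positive definite. Given $\hat x_{0|0}$ and $P_{0|0}$, for $n=1,\dots,N$ define the prediction step $$\hat x_{n|n-1}=F_n\hat x_{n-1|n-1}+B_nu_n,\qquad P_{n|n-1}=F_nP_{n-1|n-1}F_n^T+Q_n,$$ and the update step $$z_n=y_n-H_n\hat x_{n|n-1},\quad S_n=H_nP_{n|n-1}H_n^T+R_n,\quad K_n=P_{n|n-1}H_n^TS_n^{-1},$$ $$\hat x_{n|n}=\hat x_{n|n-1}+K_nz_n,\qquad P_{n|n}=(I-K_nH_n)P_{n|n-1}.$$ Here $\hat x_{n|n-1}$, $P_{n|n-1}$ are the predicted state and its covariance, $\hat x_{n|n}$, $P_{n|n}$ the posterior state and its covariance, $z_n$ the innovation, $S_n$ its covariance and $K_n$ the Kalman gain. $I$ is the identity matrix. **Gradient convention.** For a scalar function $f$ of a vector or matrix $M$, $\frac{\partial f}{\partial M}$ is the vector/matrix of the same size as $M$ such that $f(M+\delta M)=f(M)+\mathrm{tr}\bigl((\frac{\partial f}{\partial M})^T\delta M\bigr)+o(\|\delta M\|)$. For the symmetric matrix variables $P_{n|n-1},P_{n|n},Q_n,R_n,Q,R$,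 only symmetric perturbations $\delta M$ are considered and $\frac{\partial f}{\partial M}$ denotes the unique symmetric matrix with this property (i.e. the symmetric part of any unconstrained gradient). The matrix $L_n$ is unconstrained. The functions $l_{n|n-1}$, $l_{n|n}$ are assumed differentiable (on open neighbourhoods of the values of their arguments produced by the filter, in the space of vectors and symmetric matrices); $\frac{\partial l_{n|n-1}}{\partial\,\cdot}$ and $\frac{\partial l_{n|n}}{\partial\,\cdot}$ are the partial gradients with respect to their explicit arguments, evaluated at the values produced by the filter. **Meaning of $\frac{\partial\mathcal L}{\partial\,\cdot}$.** All derivatives are evaluated at the values produced by the filter, the perturbed filter being computed by the same formulas. - $\frac{\partial\mathcal L}{\partial\hat x_{n|n}}$ and $\frac{\partial\mathcal L}{\partial P_{n|n}}$ are the partial gradients of the function $(\hat x_{n|n},P_{n|n})\mapsto l_{n|n}+\sum_{m=n+1}^N(l_{m|m-1}+l_{m|m})$ obtained by treating $\hat x_{n|n}$ and $P_{n|n}$ as independent variables and running the filter equations for steps $n+1,\dots,N$ from them, with all measurements, inputs, system matrices and noise covariances fixed (variables of earlier steps are ignored). - $\frac{\partial\mathcal L}{\partial\hat x_{n|n-1}}$ and $\frac{\partial\mathcal L}{\partial P_{n|n-1}}$ are the partial gradients of the function $(\hat x_{n|n-1},P_{n|n-1})\mapsto\sum_{m=n}^N(l_{m|m-1}+l_{m|m})$ obtained by treating $\hat x_{n|n-1}$ and $P_{n|n-1}$ as independent variables, and running the update step $n$ and then the filter for steps $n+1,\dots,N$ from them. - $\frac{\partial\mathcal L}{\partial y_n}$,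 $\frac{\partial\mathcal L}{\partial Q_n}$, $\frac{\partial\mathcal L}{\partial R_n}$, $\frac{\partial\mathcal L}{\partial L_n}$ are the gradients of the full loss $\mathcal L$, computed through the filter, with respect to that single parameter, all other parameters, measurements and initial values being fixed. In the static case, $\frac{\partial\mathcal L}{\partial R}$ (resp. $\frac{\partial\mathcal L}{\partial Q}$) is the gradient of $\mathcal L$ with respect to the common value $R$ (resp. $Q$). *)

(* Defs.v *)
From HB Require Import structures.
From mathcomp Require Import all_boot all_order all_algebra.
From mathcomp Require Import all_classical all_reals all_analysis.
Set Implicit Arguments.
Unset Strict Implicit.
Unset Printing Implicit Defensive.
Import Order.TTheory GRing.Theory Num.Theory.
Import numFieldNormedType.Exports.
Local Open Scope classical_set_scope.
Local Open Scope ring_scope.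

Definition symm_mx (R : realType) (n : nat) : set 'M[R]_n := [set A | A^T = A].
Arguments symm_mx {R n}.

Definition psd_mx (R : realType) (n : nat) (A : 'M[R]_n) : Prop :=
  A^T = A /\ forall v : 'cV[R]_n, 0 <= (v^T *m A *m v) 0 0.

Definition pd_mx (R : realType) (n : nat) (A : 'M[R]_n) : Prop :=
  A^T = A /\ forall v : 'cV[R]_n, v != 0 -> 0 < (v^T *m A *m v) 0 0.

(* Differentiability of the restriction of [f] to the linear subspace [S] of
   [V] (the values of [f] outside [S] are irrelevant when [S v]): the remainder
   is a little-o of the increment [d], as [d] tends to 0 within [S]. *)
Definition differentiable_in (R : realType) (V : normedModType R) (S : set V)
    (f : V -> R) (v : V) : Prop :=
  exists D : {linear V -> R^o}, continuous D /\
    forall e : R, 0 < e ->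
      \forall d \near (0 : V), S d -> `|f (v + d) - f v - D d| <= e * `|d|.

(* Only perturbations in the subspace [S] are considered, and the gradient is
   itself in [S]; this makes it unique when [S v].  [S] is [setT] for
   unconstrained vectors or matrices and [symm_mx] for symmetric matrices. *)
Definition is_gradient (R : realType) (m n : nat) (S : set 'M[R]_(m, n))
    (f : 'M[R]_(m, n) -> R) (M G : 'M[R]_(m, n)) : Prop :=
  S G /\
  forall e : R, 0 < e ->
    \forall d \near (0 : 'M[R]_(m, n)),
      S d -> `|f (M + d) - f M - \tr (G^T *m d)| <= e * `|d|.

Definition has_gradient (R : realType) (m n : nat) (S : set 'M[R]_(m, n))
    (f : 'M[R]_(m, n) -> R) (M : 'M[R]_(m, n)) : Prop :=
  exists G, is_gradient S f M G.

(* Meaningful only under [has_gradient S f M]; it is 0 otherwise. *)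
Definition gradient (R : realType) (m n : nat) (S : set 'M[R]_(m, n))
    (f : 'M[R]_(m, n) -> R) (M : 'M[R]_(m, n)) : 'M[R]_(m, n) :=
  xget 0 [set G | is_gradient S f M G].

(* The sizes [dx n], [dy n], [du n] of state, measurement and input may depend
   on the step.  The data of step [n] have index [n >= 1]; those of index 0 are
   never used (only the sizes [dx 0] and the initial values [kx0], [kP0] are). *)
Record kalman (R : realType) (dx dy du : nat -> nat) := Kalman {
  kF : forall n, 'M[R]_(dx n, dx n.-1);
  kB : forall n, 'M[R]_(dx n, du n);
  kH : forall n, 'M[R]_(dy n, dx n);
  ku : forall n, 'cV[R]_(du n);
  kQ : forall n, 'M[R]_(dx n);
  kR : forall n, 'M[R]_(dy n);
  ky : forall n, 'cV[R]_(dy n);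
  kx0 : 'cV[R]_(dx 0);
  kP0 : 'M[R]_(dx 0) }.

Definition set_Q R dx dy du (k : kalman R dx dy du)
    (Q : forall n, 'M[R]_(dx n)) : kalman R dx dy du :=
  Kalman (kF k) (kB k) (kH k) (ku k) Q (kR k) (ky k) (kx0 k) (kP0 k).

Definition set_R R dx dy du (k : kalman R dx dy du)
    (Rn : forall n, 'M[R]_(dy n)) : kalman R dx dy du :=
  Kalman (kF k) (kB k) (kH k) (ku k) (kQ k) Rn (ky k) (kx0 k) (kP0 k).

Definition set_y R dx dy du (k : kalman R dx dy du)
    (y : forall n, 'cV[R]_(dy n)) : kalman R dx dy du :=
  Kalman (kF k) (kB k) (kH k) (ku k) (kQ k) (kR k) y (kx0 k) (kP0 k).

(* [lpred n] is a function of (x_{n|n-1}, P_{n|n-1}, R_n, y_n), and [lpost n]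
   of (x_{n|n}, P_{n|n}). *)
Record kalman_loss (R : realType) (dx dy : nat -> nat) := KalmanLoss {
  lpred : forall n,
    'cV[R]_(dx n) * 'M[R]_(dx n) * 'M[R]_(dy n) * 'cV[R]_(dy n) -> R;
  lpost : forall n, 'cV[R]_(dx n) * 'M[R]_(dx n) -> R }.
Arguments lpred {R dx dy} l n a : rename.
Arguments lpost {R dx dy} l n a : rename.

Section Filter.
Context (R : realType) (dx dy du : nat -> nat) (k : kalman R dx dy du).

Definition kf_state (n : nat) : Type := ('cV[R]_(dx n) * 'M[R]_(dx n))%type.

Definition kf_predict (n : nat) (s : kf_state n.-1) : kf_state n :=
  (kF k n *m s.1 + kB k n *m ku k n, kF k n *m s.2 *m (kF k n)^T + kQ k n).

Definition innovation (n : nat) (s : kf_state n) : 'cV[R]_(dy n) :=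
  ky k n - kH k n *m s.1.

Definition innovation_cov (n : nat) (s : kf_state n) : 'M[R]_(dy n) :=
  kH k n *m s.2 *m (kH k n)^T + kR k n.

Definition gain (n : nat) (s : kf_state n) : 'M[R]_(dx n, dy n) :=
  s.2 *m (kH k n)^T *m invmx (innovation_cov s).

Definition kf_update (n : nat) (s : kf_state n) : kf_state n :=
  (s.1 + gain s *m innovation s, (1%:M - gain s *m kH k n) *m s.2).

Fixpoint kf_post (n : nat) : kf_state n :=
  match n with
  | 0 => (kx0 k, kP0 k)
  | n'.+1 => kf_update (kf_predict (n := n'.+1) (kf_post n'))
  end.

Definition kf_pred (n : nat) : kf_state n := kf_predict (kf_post n.-1).

Variable l : kalman_loss R dx dy.

Definition loss (N : nat) : R :=
  \sum_(1 <= n < N.+1)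
    (lpost l n (kf_post n)
     + lpred l n ((kf_pred n).1, (kf_pred n).2, kR k n, ky k n)).

(* \sum_{m = n+1}^{n+j} (l_{m|m-1} + l_{m|m}) along the filter run from the
   posterior state [s] at step [n]. *)
Fixpoint tail_loss (j n : nat) (s : kf_state n) {struct j} : R :=
  match j with
  | 0 => 0
  | j'.+1 =>
      let sp := kf_predict (n := n.+1) s in
      let su := kf_update sp in
      lpred l n.+1 (sp.1, sp.2, kR k n.+1, ky k n.+1) + lpost l n.+1 su
        + tail_loss j' su
  end.

(* The loss [\mathcal L] as a function of the posterior, resp. predicted, state
   of step [n], the terms of earlier times being dropped. *)
Definition loss_from_post (N n : nat) (s : kf_state n) : R :=
  lpost l n s + tail_loss (N - n)%N s.

Definition loss_from_pred (N n : nat) (s : kf_state n) : R :=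
  lpred l n (s.1, s.2, kR k n, ky k n) + loss_from_post N (kf_update s).

End Filter.

Arguments loss {R dx dy du} k l N.
Arguments loss_from_post {R dx dy du} k l N n s.
Arguments loss_from_pred {R dx dy du} k l N n s.

Section Derivatives.
Context (R : realType) (dx dy du : nat -> nat).
Variables (k : kalman R dx dy du) (l : kalman_loss R dx dy) (N : nat).

(* The loss as a function of one single variable, the others being fixed at the
   values produced by the filter. *)
Definition L_xpost n (x : 'cV[R]_(dx n)) : R :=
  loss_from_post k l N n (x, (kf_post k n).2).
Definition L_Ppost n (P : 'M[R]_(dx n)) : R :=
  loss_from_post k l N n ((kf_post k n).1, P).
Definition L_xpred n (x : 'cV[R]_(dx n)) : R :=
  loss_from_pred k l N n (x, (kf_pred k n).2).
Definition L_Ppred n (P : 'M[R]_(dx n)) : R :=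
  loss_from_pred k l N n ((kf_pred k n).1, P).
Definition L_y n (v : 'cV[R]_(dy n)) : R :=
  loss (set_y k (eqtype.dfwith (ky k) v)) l N.
Definition L_Q n (M : 'M[R]_(dx n)) : R :=
  loss (set_Q k (eqtype.dfwith (kQ k) M)) l N.
Definition L_R n (M : 'M[R]_(dy n)) : R :=
  loss (set_R k (eqtype.dfwith (kR k) M)) l N.

Definition dL_xpost n := gradient setT (L_xpost (n := n)) (kf_post k n).1.
Definition dL_Ppost n := gradient symm_mx (L_Ppost (n := n)) (kf_post k n).2.
Definition dL_xpred n := gradient setT (L_xpred (n := n)) (kf_pred k n).1.
Definition dL_Ppred n := gradient symm_mx (L_Ppred (n := n)) (kf_pred k n).2.
Definition dL_y n := gradient setT (L_y (n := n)) (ky k n).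
Definition dL_Q n := gradient symm_mx (L_Q (n := n)) (kQ k n).
Definition dL_R n := gradient symm_mx (L_R (n := n)) (kR k n).

Definition dlpost_x n :=
  gradient setT (fun x => lpost l n (x, (kf_post k n).2)) (kf_post k n).1.
Definition dlpost_P n :=
  gradient symm_mx (fun P => lpost l n ((kf_post k n).1, P)) (kf_post k n).2.
Definition dlpred_x n :=
  gradient setT (fun x => lpred l n (x, (kf_pred k n).2, kR k n, ky k n))
    (kf_pred k n).1.
Definition dlpred_P n :=
  gradient symm_mx (fun P => lpred l n ((kf_pred k n).1, P, kR k n, ky k n))
    (kf_pred k n).2.
Definition dlpred_R n :=
  gradient symm_mx
    (fun M => lpred l n ((kf_pred k n).1, (kf_pred k n).2, M, ky k n)) (kR k n).
Definition dlpred_y n :=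
  gradient setT
    (fun v => lpred l n ((kf_pred k n).1, (kf_pred k n).2, kR k n, v)) (ky k n).

End Derivatives.

Arguments L_xpost {R dx dy du} k l N n.
Arguments L_Ppost {R dx dy du} k l N n.
Arguments L_xpred {R dx dy du} k l N n.
Arguments L_Ppred {R dx dy du} k l N n.
Arguments L_y {R dx dy du} k l N n.
Arguments L_Q {R dx dy du} k l N n.
Arguments L_R {R dx dy du} k l N n.

Definition const_mx_family (R : realType) (d : nat -> nat) (m : nat)
    (e : forall n, d n = m) (A : 'M[R]_m) : forall n, 'M[R]_(d n) :=
  fun n => castmx (esym (e n), esym (e n)) A.

(* Main.v *)
Require Import Defs.
From HB Require Import structures.
From mathcomp Require Import all_boot all_order all_algebra.
From mathcomp Require Import all_classical all_reals all_analysis.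
From mathcomp Require Import ring lra.
Set Implicit Arguments.
Unset Strict Implicit.
Unset Printing Implicit Defensive.
Import Order.TTheory GRing.Theory Num.Theory.
Import numFieldNormedType.Exports.
Local Open Scope classical_set_scope.
Local Open Scope ring_scope.

(** Treat the noise parameters and measurements as affine functions of a
    parameter [t].  By backward induction on [n], the loss still to come after
    step [n] is jointly differentiable in the posterior state of step [n] and in
    [t], along symmetric perturbations of the covariance; the chain rule through
    one filter step turns the differential at step [n+1] into that at step [n].
    With [A = I - K H], the step has the differentials
    [dK = A dP H^T S^-1 - K dR S^-1] and [dP_post = A dP A^T + K dR K^T], and
    [S^-1 H = R^-1 H A] brings the result into the stated form.  Every gradient
    of the theorem is read off for a suitable [t]: a single [y_n], [Q_n] or
    [R_n], or the common value [Q] or [R]. *)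

(** The losses are differentiable only along symmetric covariances, and the formula for the
    posterior covariance differential itself uses symmetry ([K^T = S^-1 H P]). Hence all derivatives
    are relative to a set of admissible increments, and the chain rule demands that the true
    increment of the inner map, not just its linear part, be admissible. Positivity is carried only
    along the unperturbed filter, where it makes [R_n] and [S_n] invertible; near such a point the
    inverse has a quadratic expansion, so perturbed filters need no positivity. Since [gradient] is
    a choice operator, each equation is proved by showing that its right-hand side is a gradient and
    then invoking uniqueness. The halves in the statement come from symmetrization: a rank-one
    matrix such as [gx z^T R^-1 H] acts on symmetric increments only through its symmetric part. The
    space of [t] is an arbitrary normed module, so one induction serves vectors and matrices alike;
    data constant in [t] give the state equations. *)

(** * Entrywise norm estimates and the expansion of the matrix inverse *)

Section MatrixNorm.
Variable R : realType.
Implicit Types (m n p : nat).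

Lemma entry_le_mx_norm m n (A : 'M[R]_(m, n)) i j : `|A i j| <= `|A|.
Proof.
by rewrite [leRHS]/Num.Def.normr /= mx_normrE; apply: (le_bigmax _ _ (i, j)).
Qed.

Lemma mx_norm_le m n (A : 'M[R]_(m, n)) c :
  0 <= c -> (forall i j, `|A i j| <= c) -> `|A| <= c.
Proof.
by move=> c0 Ac; rewrite [leLHS]/Num.Def.normr /= mx_normrE; apply: bigmax_le => // -[].
Qed.

Lemma sum_ord_le_const n (F : 'I_n -> R) c :
  (forall i, F i <= c) -> \sum_i F i <= n%:R * c.
Proof.
move=> Fc; apply: (le_trans (ler_sum _ (fun i _ => Fc i))).
by rewrite sumr_const card_ord mulr_natl.
Qed.

(** The norm is the largest absolute entry, which is not submultiplicative; the factor [n] counts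
    the terms in an entry of the product. *)
Lemma mx_norm_mulmx m n p (A : 'M[R]_(m, n)) (B : 'M[R]_(n, p)) :
  `|A *m B| <= n%:R * (`|A| * `|B|).
Proof.
apply: mx_norm_le => [|i j]; first by rewrite !mulr_ge0.
rewrite mxE (le_trans (ler_norm_sum _ _ _)) //.
apply: sum_ord_le_const => s.
by rewrite normrM ler_pM // entry_le_mx_norm.
Qed.

Lemma mx_norm_trmx m n (A : 'M[R]_(m, n)) : `|A^T| = `|A|.
Proof.
have le_tr p q (B : 'M[R]_(p, q)) : `|B^T| <= `|B|.
  by apply: mx_norm_le => // i j; rewrite mxE entry_le_mx_norm.
by apply/eqP; rewrite eq_le le_tr -{1}[A]trmxK le_tr.
Qed.

Lemma norm_mxtrace n (A : 'M[R]_n) : `|\tr A| <= n%:R * `|A|.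
Proof.
rewrite (le_trans (ler_norm_sum _ _ _)) //.
apply: sum_ord_le_const => s.
exact: entry_le_mx_norm.
Qed.

Lemma mxtrace_trmul_ge0 m n (A : 'M[R]_(m, n)) : 0 <= \tr (A^T *m A).
Proof.
apply: sumr_ge0 => j _; rewrite mxE sumr_ge0 // => i _.
by rewrite mxE -expr2 sqr_ge0.
Qed.

(** The trace is the squared Frobenius norm, a sum of squares of the entries. Applied to the
    difference of two gradients, it yields their equality. *)
Lemma mxtrace_trmul_eq0 m n (A : 'M[R]_(m, n)) : \tr (A^T *m A) = 0 -> A = 0.
Proof.
move=> /eqP; rewrite psumr_eq0 => [/allP A0|j _]; last first.
  by rewrite mxE sumr_ge0 // => i _; rewrite mxE -expr2 sqr_ge0.
apply/matrixP => i j; move: (A0 j); rewrite mem_index_enum => /(_ isT) /=.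
rewrite mxE psumr_eq0 => [/allP/(_ i)|s _]; last by rewrite mxE -expr2 sqr_ge0.
by rewrite mem_index_enum mxE -expr2 sqrf_eq0 mxE => /(_ isT)/eqP.
Qed.

(** A row [v] of the kernel satisfies [v = - v A], so its norm is at most [n |A| |v|], which is less
    than [|v|] unless [v = 0]. *)
Lemma unitmx_1D n (A : 'M[R]_n) : n%:R * `|A| < 1 -> 1%:M + A \in unitmx.
Proof.
move=> nA; rewrite -row_free_unit -kermx_eq0; apply/eqP/row_matrixP => i.
rewrite row0; set v := row i _.
have /sub_kermxP : (v <= kermx (1%:M + A))%MS by exact: row_sub.
rewrite mulmxDr mulmx1 => /eqP; rewrite addr_eq0 => /eqP vE.
apply/eqP; rewrite -normr_eq0 eq_le normr_ge0 andbT leNgt; apply/negP => v0.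
have : `|v| <= n%:R * `|A| * `|v|.
  rewrite {1}vE normrN (le_trans (mx_norm_mulmx _ _)) //.
  by rewrite -mulrA ler_wpM2l // mulrC.
by rewrite leNgt -{2}[`|v|]mul1r ltr_pM2r // nA.
Qed.

Lemma unitmx_near n (A : 'M[R]_n) : A \in unitmx ->
  \forall d \near (0 : 'M[R]_n), A + d \in unitmx.
Proof.
(* For [|d| < 1/C] the factor [1 + A^-1 d] falls under [unitmx_1D]; the added 1 only keeps [C]
   positive. *)
move=> uA; pose C := n%:R * (n%:R * `|invmx A|) + 1.
have C0 : 0 < C by rewrite ltr_wpDl // !mulr_ge0.
apply/nbhs_norm0P; exists C^-1 => /= [|d dC]; first by rewrite invr_gt0.
have -> : A + d = A *m (1%:M + invmx A *m d).
  by rewrite mulmxDr mulmx1 mulmxA mulmxV // mul1mx.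
rewrite unitmx_mul uA unitmx_1D //.
have h : n%:R * `|invmx A *m d| <= (C - 1) * `|d|.
  by rewrite /C addrK -mulrA ler_wpM2l // -mulrA mx_norm_mulmx.
rewrite (le_lt_trans h) // (@le_lt_trans _ _ (C * `|d|)) //.
  by rewrite ler_wpM2r // gerBl.
by rewrite mulrC -ltr_pdivlMr // div1r.
Qed.

(** With [X = (A + d)^-1] and [Y = A^-1], the resolvent identity [X = Y - Y d X] bounds [|X|] by
    [|Y| + |X| / 2] once [|d| < 1/C]; hence the factor 2. *)
Lemma invmx_near_bounded n (A : 'M[R]_n) : A \in unitmx ->
  \forall d \near (0 : 'M[R]_n), `|invmx (A + d)| <= 2 * `|invmx A|.
Proof.
move=> uA; pose C := 2 * (n%:R * (n%:R * `|invmx A|)) + 1.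
have C0 : 0 < C by rewrite ltr_wpDl // !mulr_ge0.
have dC : \forall d \near (0 : 'M[R]_n), `|d| < C^-1.
  by apply: nbhs0_lt; rewrite invr_gt0.
apply: filterS2 dC (unitmx_near uA) => d dC uAd.
have dC1 : C * `|d| <= 1 by rewrite mulrC -ler_pdivlMr // div1r ltW.
set X := invmx (A + d).
have XE : X = invmx A - invmx A *m (d *m X).
  apply/eqP; rewrite eq_sym subr_eq.
  have {1}-> : invmx A = invmx A *m (A + d) *m X by rewrite -mulmxA mulmxV // mulmx1.
  by rewrite mulmxDr mulVmx // mulmxDl mul1mx mulmxA.
have h : `|X| <= `|invmx A| + n%:R * (`|invmx A| * (n%:R * (`|d| * `|X|))).
  rewrite {1}XE (le_trans (ler_normB _ _)) // lerD2l.
  rewrite (le_trans (mx_norm_mulmx _ _)) // ler_wpM2l // ler_wpM2l //.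
  exact: mx_norm_mulmx.
have {dC} : (C - 1) * `|d| * `|X| <= `|X|.
  by rewrite ler_piMl // (le_trans _ dC1) // ler_wpM2r // gerBl.
by rewrite /C addrK; nra.
Qed.

(** Applying the resolvent identity twice, the remainder equals [Y d Y d X], which is quadratic in
    [d] because [X] stays bounded. *)
Lemma invmx_expansion n (A : 'M[R]_n) : A \in unitmx ->
  exists C, \forall d \near (0 : 'M[R]_n),
    `|invmx (A + d) - invmx A + invmx A *m d *m invmx A| <= C * (`|d| * `|d|).
Proof.
move=> uA; pose a := n%:R * `|invmx A|.
exists (n%:R * (n%:R * (a * a) * (2 * `|invmx A|))).
apply: filterS2 (invmx_near_bounded uA) (unitmx_near uA) => d.
set X := invmx (A + d); set Y := invmx A => bX uAd.
have XY : X - Y = - (Y *m d *m X).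
  have {1}-> : Y = Y *m (A + d) *m X by rewrite -mulmxA mulmxV // mulmx1.
  by rewrite mulmxDr mulVmx // mulmxDl mul1mx opprD addrA subrr sub0r.
have -> : X - Y + Y *m d *m Y = (Y *m d) *m (Y *m d) *m X.
  rewrite XY addrC -mulmxBr -opprB XY opprK.
  by rewrite !mulmxA.
rewrite (le_trans (mx_norm_mulmx _ _)) // -!mulrA ler_wpM2l //.
have nYd : `|Y *m d| <= n%:R * (`|Y| * `|d|) by exact: mx_norm_mulmx.
have h2 : `|Y *m d *m (Y *m d)|
    <= n%:R * ((n%:R * (`|Y| * `|d|)) * (n%:R * (`|Y| * `|d|))).
  by rewrite (le_trans (mx_norm_mulmx _ _)) // ler_wpM2l // ler_pM.
rewrite (le_trans (ler_pM _ _ h2 bX)) //.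
by rewrite le_eqVlt /a; apply/orP; left; apply/eqP; rewrite -/Y; ring.
Qed.

End MatrixNorm.

(** * Linear bounds, Landau symbols and derivatives along admissible increments *)

Definition norm_bounded (R : realType) (V W : normedModType R) (D : V -> W) :=
  exists C : R, forall d, `|D d| <= C * `|d|.

Section NormBounded.
Variables (R : realType) (V W X : normedModType R).

Lemma norm_boundedD (D E : V -> W) :
  norm_bounded D -> norm_bounded E -> norm_bounded (fun d => D d + E d).
Proof.
move=> [C DC] [B EB]; exists (C + B) => d.
by rewrite (le_trans (ler_normD _ _)) // mulrDl lerD.
Qed.

Lemma norm_bounded_comp (D : V -> W) (E : W -> X) :
  norm_bounded D -> norm_bounded E -> norm_bounded (fun d => E (D d)).
Proof.
move=> [C DC] [B EB]; exists (`|B| * C) => d; rewrite (le_trans (EB _)) //.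
rewrite -mulrA (@le_trans _ _ (`|B| * `|D d|)) ?ler_wpM2l //.
by rewrite ler_wpM2r // ler_norm.
Qed.

Lemma norm_bounded0 : norm_bounded (fun _ : V => 0 : W).
Proof. by exists 0 => d; rewrite normr0 mul0r. Qed.

Lemma norm_fst_le (d : V * W) : `|d.1| <= `|d|.
Proof. by rewrite prod_normE le_max lexx. Qed.

Lemma norm_snd_le (d : V * W) : `|d.2| <= `|d|.
Proof. by rewrite prod_normE le_max lexx orbT. Qed.

Lemma norm_pairr0 (d : V) : `|(d, 0) : V * W| <= `|d|.
Proof. by rewrite prod_normE normr0 ge_max lexx /=. Qed.

Lemma norm_pair0r (d : W) : `|(0, d) : V * W| <= `|d|.
Proof. by rewrite prod_normE normr0 ge_max lexx andbT /=. Qed.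

Lemma norm_bounded_fst : norm_bounded (@fst V W).
Proof. by exists 1 => d; rewrite mul1r norm_fst_le. Qed.

Lemma norm_bounded_snd : norm_bounded (@snd V W).
Proof. by exists 1 => d; rewrite mul1r norm_snd_le. Qed.

End NormBounded.

Lemma norm_bounded_sum (R : realType) (V W : normedModType R) (r : seq nat)
    (D : nat -> V -> W) :
  (forall m, m \in r -> norm_bounded (D m)) ->
  norm_bounded (fun d => \sum_(m <- r) D m d).
Proof.
elim: r => [|m r IHr] Dr.
  by have [C h] := norm_bounded0 V W; exists C => d; rewrite big_nil.
have Dm : norm_bounded (D m) by apply: Dr; rewrite mem_head.
have Ds : norm_bounded (fun d => \sum_(m <- r) D m d).
  by apply: IHr => i ir; apply: Dr; rewrite inE ir orbT.
have [C h] := norm_boundedD Dm Ds; exists C => d; rewrite big_cons.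
exact: h.
Qed.

(** [S] restricts the increment [d], not the point. The constant is positive so that later proofs
    may divide by it. *)
Definition bigO_on (R : realType) (V W : normedModType R) (S : set V)
    (r : V -> W) : Prop :=
  exists C : R, 0 < C /\ \forall d \near (0 : V), S d -> `|r d| <= C * `|d|.

Definition littleo_on (R : realType) (V W : normedModType R) (S : set V)
    (r : V -> W) : Prop :=
  forall e : R, 0 < e -> \forall d \near (0 : V), S d -> `|r d| <= e * `|d|.

(* [D] is not required to be linear: only the outer map of a composition needs an
   additive derivative. *)
Definition deriv_on (R : realType) (V W : normedModType R) (S : set V)
    (f : V -> W) (v : V) (D : V -> W) : Prop :=
  bigO_on S D /\ littleo_on S (fun d => f (v + d) - f v - D d).

Section Landau.
Variables (R : realType) (V : normedModType R) (S : set V).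
Implicit Types W X : normedModType R.

Lemma littleo_on_bigO W (r : V -> W) : littleo_on S r -> bigO_on S r.
Proof. by move=> /(_ 1 ltr01) ro; exists 1. Qed.

Lemma eq_littleo_on W (r r' : V -> W) :
  (forall d, S d -> r d = r' d) -> littleo_on S r -> littleo_on S r'.
Proof.
by move=> rr' ro e /ro; apply: filterS => d rd Sd; rewrite -rr' ?rd.
Qed.

Lemma eq_bigO_on W (r r' : V -> W) :
  (forall d, S d -> r d = r' d) -> bigO_on S r -> bigO_on S r'.
Proof.
move=> rr' [C [C0 rC]]; exists C; split => //.
by apply: filterS rC => d rd Sd; rewrite -rr' ?rd.
Qed.

Lemma littleo_on0 W : littleo_on S (fun=> 0 : W).
Proof.
by move=> e e0; apply: nearW => d _; rewrite normr0 mulr_ge0 // ltW.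
Qed.

Lemma littleo_onD W (r r' : V -> W) :
  littleo_on S r -> littleo_on S r' -> littleo_on S (fun d => r d + r' d).
Proof.
move=> ro ro' e e0; have e20 : 0 < e / 2 by rewrite divr_gt0.
apply: filterS2 (ro _ e20) (ro' _ e20) => d rd rd' Sd.
rewrite (le_trans (ler_normD _ _)) // [e]splitr mulrDl.
by rewrite lerD ?rd ?rd'.
Qed.

Lemma bigO_onD W (r r' : V -> W) :
  bigO_on S r -> bigO_on S r' -> bigO_on S (fun d => r d + r' d).
Proof.
move=> [C [C0 rC]] [C' [C'0 rC']]; exists (C + C'); split; first exact: addr_gt0.
apply: filterS2 rC rC' => d rd rd' Sd.
by rewrite (le_trans (ler_normD _ _)) // mulrDl lerD ?rd ?rd'.
Qed.

Lemma littleo_on_bounded W W' (A : W -> W') (r : V -> W) :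
  norm_bounded A ->
  littleo_on S r -> littleo_on S (fun d => A (r d)).
Proof.
(* [norm_bounded] puts no sign on [C]; [C'] is a positive majorant that can be divided by. *)
move=> [C AC] ro e e0; pose C' := `|C| + 1.
have C'0 : 0 < C' by rewrite ltr_wpDl.
have eC0 : 0 < e / C' by rewrite divr_gt0.
apply: filterS (ro _ eC0) => d rd Sd; rewrite (le_trans (AC _)) //.
rewrite (@le_trans _ _ (C' * `|r d|)) //.
  by rewrite ler_wpM2r // (le_trans (ler_norm _)) // lerDl.
by rewrite mulrC -ler_pdivlMr // mulrAC rd.
Qed.

Lemma bigO_on_bounded W W' (A : W -> W') (r : V -> W) :
  norm_bounded A ->
  bigO_on S r -> bigO_on S (fun d => A (r d)).
Proof.
move=> [C AC] [B [B0 rB]]; exists ((`|C| + 1) * B).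
split; first by rewrite mulr_gt0 // ltr_wpDl.
apply: filterS rB => d rd Sd; rewrite (le_trans (AC _)) // -mulrA.
rewrite (@le_trans _ _ ((`|C| + 1) * `|r d|)) ?ler_wpM2l ?rd ?addr_ge0 //.
by rewrite ler_wpM2r // (le_trans (ler_norm _)) // lerDl.
Qed.

(** Two factors of order [d] make a quadratic remainder; restricting to [|d| < e / C'] absorbs one
    power of [|d|] into [e]. The product and inverse rules both end here. *)
Lemma littleo_on_prod W W1 W2 (r : V -> W) (q1 : V -> W1) (q2 : V -> W2) C :
  bigO_on S q1 -> bigO_on S q2 ->
  (\forall d \near (0 : V), S d -> `|r d| <= C * (`|q1 d| * `|q2 d|)) ->
  littleo_on S r.
Proof.
move=> [B1 [B10 qB1]] [B2 [B20 qB2]] rC e e0.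
pose C' := (`|C| + 1) * (B1 * B2).
have C'0 : 0 < C' by rewrite mulr_gt0 ?mulr_gt0 // ltr_wpDl.
have dC : \forall d \near (0 : V), `|d| < e / C'.
  by apply: nbhs0_lt; rewrite divr_gt0.
apply: filterS2 (filterI dC rC) (filterI qB1 qB2).
move=> d [{}dC rd] [qd1 qd2] Sd.
rewrite (le_trans (rd Sd)) //.
rewrite (@le_trans _ _ ((`|C| + 1) * (`|q1 d| * `|q2 d|))) //.
  by rewrite ler_wpM2r ?mulr_ge0 // (le_trans (ler_norm _)) // lerDl.
rewrite (@le_trans _ _ ((`|C| + 1) * ((B1 * `|d|) * (B2 * `|d|)))) //.
  by rewrite ler_wpM2l ?addr_ge0 // ler_pM ?qd1 ?qd2.
have -> : (`|C| + 1) * ((B1 * `|d|) * (B2 * `|d|)) = (`|d| * C') * `|d|.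
  by rewrite /C'; ring.
by rewrite ler_wpM2r // -ler_pdivlMr // ltW.
Qed.

End Landau.

Section Deriv.
Variables (R : realType) (V : normedModType R) (S : set V).
Implicit Types W X : normedModType R.

Lemma eq_deriv_on W (f f' : V -> W) v D D' :
  (forall d, S d -> f (v + d) = f' (v + d)) -> f v = f' v ->
  (forall d, S d -> D d = D' d) ->
  deriv_on S f v D -> deriv_on S f' v D'.
Proof.
move=> ff' fv DD' [DO fo]; split; first exact: eq_bigO_on DD' DO.
by apply: eq_littleo_on fo => d Sd; rewrite ff' // fv DD'.
Qed.

Lemma deriv_on_incr W (f : V -> W) v D : deriv_on S f v D ->
  bigO_on S (fun d => f (v + d) - f v).
Proof.
move=> [DO /littleo_on_bigO/bigO_onD/(_ DO)]; apply: eq_bigO_on => d _.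
by rewrite subrK.
Qed.

Lemma bounded_bigO_on W (D : V -> W) :
  norm_bounded D -> bigO_on S D.
Proof.
move=> [C DC]; exists (`|C| + 1); split; first by rewrite ltr_wpDl.
apply: nearW => d _; rewrite (le_trans (DC d)) // ler_wpM2r //.
by rewrite (le_trans (ler_norm _)) // lerDl.
Qed.

Lemma deriv_on_cst W (w : W) v : deriv_on S (fun=> w) v (fun=> 0).
Proof.
split; first exact/littleo_on_bigO/littleo_on0.
by apply: eq_littleo_on (littleo_on0 S W) => d _; rewrite subrr subr0.
Qed.

Lemma deriv_onD W (f g : V -> W) v D E :
  deriv_on S f v D -> deriv_on S g v E ->
  deriv_on S (fun x => f x + g x) v (fun d => D d + E d).
Proof.
move=> [DO fo] [EO go]; split; first exact: bigO_onD.
apply: eq_littleo_on (littleo_onD fo go) => d _.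
by rewrite !opprD addrACA; congr (_ + _); rewrite addrACA.
Qed.

(** The remainder splits into that of [g] at the true increment of [f], plus [E] applied to the
    remainder of [f]. Additivity of [E] performs the splitting, its bound controls the second part,
    and the last hypothesis makes the first part admissible for [g]. *)
Lemma deriv_on_comp W X (T : set W) (g : W -> X) (E : W -> X)
    (f : V -> W) v D :
  (forall a b, E (a - b) = E a - E b) ->
  norm_bounded E ->
  deriv_on T g (f v) E -> deriv_on S f v D ->
  (forall d, S d -> T (f (v + d) - f v)) ->
  deriv_on S (fun x => g (f x)) v (fun d => E (D d)).
Proof.
move=> EB EC [EO go] fd ST; have [DO fo] := fd.
split; first exact: bigO_on_bounded.
have [C [C0 fC]] := deriv_on_incr fd.
have ro : littleo_on S (fun d =>
    g (f v + (f (v + d) - f v)) - g (f v) - E (f (v + d) - f v)).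
  (* The increment of [f] is at most [C |d|], so precision [e / C] for [g] yields precision [e] in
     [d]. *)
  move=> e e0; have eC0 : 0 < e / C by rewrite divr_gt0.
  have /nbhs_norm0P[h /= h0 gh] := go _ eC0.
  have dC : \forall d \near (0 : V), `|d| < h / C.
    by apply: nbhs0_lt; rewrite divr_gt0.
  apply: filterS2 dC fC => d dC fd' Sd.
  have fh : `|f (v + d) - f v| < h.
    by rewrite (le_lt_trans (fd' Sd)) // mulrC -ltr_pdivlMr.
  rewrite (le_trans (gh _ fh (ST _ Sd))) // mulrAC ler_pdivrMr // -mulrA.
  by rewrite (ler_wpM2l (ltW e0)) // mulrC fd'.
apply: eq_littleo_on (littleo_onD ro (littleo_on_bounded EC fo)) => d _.
by rewrite (EB (f (v + d) - f v)) addrA subrK subrKC.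
Qed.

Lemma deriv_on_pair W X (f : V -> W) (g : V -> X) v D E :
  deriv_on S f v D -> deriv_on S g v E ->
  deriv_on S (fun x => (f x, g x)) v (fun d => (D d, E d)).
Proof.
move=> [[C [C0 DC]] fo] [[B [B0 EB]] go]; split.
  exists (C + B); split; first exact: addr_gt0.
  apply: filterS2 DC EB => d Dd Ed Sd.
  rewrite prod_normE ge_max /=.
  by rewrite (le_trans (Dd Sd)) ?(le_trans (Ed Sd)) // ler_wpM2r // ?lerDl ?lerDr ltW.
move=> e e0; apply: filterS2 (fo _ e0) (go _ e0) => d fd gd Sd.
by rewrite prod_normE ge_max fd ?gd.
Qed.

Lemma deriv_on_mulmx m n p (f : V -> 'M[R]_(m, n)) (g : V -> 'M[R]_(n, p))
    v D E :
  deriv_on S f v D -> deriv_on S g v E ->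
  deriv_on S (fun x => f x *m g x) v (fun d => D d *m g v + f v *m E d).
Proof.
move=> fd gd; have [DO fo] := fd; have [EO go] := gd.
have mulr_bounded q r s (B : 'M[R]_(r, s)) :
    norm_bounded (fun w : 'M[R]_(q, r) => w *m B).
  exists (r%:R * `|B|) => w; rewrite (le_trans (mx_norm_mulmx _ _)) //.
  by rewrite [`|w| * _]mulrC mulrA.
have mull_bounded q r s (B : 'M[R]_(q, r)) :
    norm_bounded (fun w : 'M[R]_(r, s) => B *m w).
  by exists (r%:R * `|B|) => w; rewrite -mulrA mx_norm_mulmx.
split.
  apply: bigO_onD; first exact: bigO_on_bounded (mulr_bounded _ _ _ _) DO.
  exact: bigO_on_bounded (mull_bounded _ _ _ _) EO.
(* The second-order term of the product rule; what is left of the remainder is linear in the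
   remainders of [f] and [g]. *)
have ro : littleo_on S (fun d => (f (v + d) - f v) *m (g (v + d) - g v)).
  apply: (littleo_on_prod (C := n%:R) (deriv_on_incr fd) (deriv_on_incr gd)).
  by apply: nearW => d _; exact: mx_norm_mulmx.
have fo' := littleo_on_bounded (mulr_bounded _ _ _ (g v)) fo.
have go' := littleo_on_bounded (mull_bounded _ _ _ (f v)) go.
apply: eq_littleo_on (littleo_onD (littleo_onD fo' go') ro) => d _.
rewrite !(mulmxBr, mulmxBl).
set a := f (v + d) *m g (v + d); set b := f (v + d) *m g v.
set c := f v *m g (v + d); set x := f v *m g v.
rewrite !opprB opprD; move: (D d *m _) (f v *m E d) => y z.
by apply/matrixP => i j; rewrite !mxE; ring.
Qed.

Lemma deriv_on_invmx n (f : V -> 'M[R]_n) v D : f v \in unitmx ->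
  deriv_on S f v D ->
  deriv_on S (fun x => invmx (f x)) v
    (fun d => - (invmx (f v) *m D d *m invmx (f v))).
Proof.
move=> uf fd; have [DO fo] := fd; set Y := invmx (f v).
pose A w : 'M[R]_n := - (Y *m w *m Y).
have AC : norm_bounded A.
  exists (n%:R * (n%:R * `|Y| * `|Y|)) => w.
  rewrite normrN (le_trans (mx_norm_mulmx _ _)) // -!mulrA ler_wpM2l //.
  rewrite (le_trans (ler_wpM2r _ (mx_norm_mulmx _ _))) //.
  by rewrite le_eqVlt; apply/orP; left; apply/eqP; ring.
split; first exact: bigO_on_bounded AC DO.
have [C invC] := invmx_expansion uf.
have ro : littleo_on S (fun d =>
    invmx (f v + (f (v + d) - f v)) - Y + Y *m (f (v + d) - f v) *m Y).
  have [B [B0 fB]] := deriv_on_incr fd.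
  apply: (littleo_on_prod (C := C) (deriv_on_incr fd) (deriv_on_incr fd)).
  have /nbhs_norm0P[h /= h0 gh] := invC.
  have dC : \forall d \near (0 : V), `|d| < h / B.
    by apply: nbhs0_lt; rewrite divr_gt0.
  apply: filterS2 dC fB => d dB fd' Sd; apply: gh => /=.
  by rewrite (le_lt_trans (fd' Sd)) // mulrC -ltr_pdivlMr.
apply: eq_littleo_on (littleo_onD ro (littleo_on_bounded AC fo)) => d _.
rewrite /A [f v + _]addrC subrK opprK.
rewrite [Y *m (_ - _ - D d)]mulmxBr mulmxBl opprB addrA.
by rewrite addrAC -[_ + _ - Y *m _ *m Y]addrA subrr addr0.
Qed.

End Deriv.

Section DerivMore.
Variables (R : realType) (V : normedModType R) (S : set V).
Implicit Types W X : normedModType R.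

Lemma deriv_on_affine W (f : V -> W) v D :
  (forall d, f (v + d) = f v + D d) ->
  norm_bounded D -> deriv_on S f v D.
Proof.
move=> fD DC; split; first exact: bounded_bigO_on.
apply: eq_littleo_on (littleo_on0 S W) => d _.
by rewrite fD -addrA -opprD subrr.
Qed.

(** Used when [i] inserts one component into a tuple or projects onto one. As [i] has no remainder,
    no additivity of [E] is involved, and the bound on [i0] transports neighbourhoods of 0. *)
Lemma deriv_on_pullback W X (T : set W) (g : W -> X) E (i i0 : V -> W) v :
  (forall d, i (v + d) = i v + i0 d) -> (forall d, `|i0 d| <= `|d|) ->
  (forall d, S d -> T (i0 d)) ->
  deriv_on T g (i v) E -> deriv_on S (fun x => g (i x)) v (fun d => E (i0 d)).
Proof.
move=> iD i01 iS [[C [C0 EC]] go].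
have pull (r : W -> Prop) : (\forall w \near (0 : W), r w) ->
    \forall d \near (0 : V), r (i0 d).
  move=> /nbhs_norm0P[h /= h0 rh]; apply/nbhs_norm0P; exists h => // d /= dh.
  by apply: rh => /=; rewrite (le_lt_trans (i01 d)).
split.
  exists C; split => //; apply: filterS (pull _ EC) => d Ed Sd.
  by rewrite (le_trans (Ed (iS _ Sd))) // ler_wpM2l // ltW.
move=> e e0; apply: filterS (pull _ (go _ e0)) => d gd Sd.
by rewrite iD (le_trans (gd (iS _ Sd))) // ler_wpM2l // ltW.
Qed.

Lemma deriv_onN W (f : V -> W) v D :
  deriv_on S f v D -> deriv_on S (fun x => - f x) v (fun d => - D d).
Proof.
have N1 : norm_bounded (fun w : W => - w).
  by exists 1 => w; rewrite normrN mul1r.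
move=> [DO fo]; split; first exact: bigO_on_bounded N1 DO.
apply: eq_littleo_on (littleo_on_bounded N1 fo) => d _.
by rewrite !opprD.
Qed.

Lemma deriv_on_mull m n p (A : 'M[R]_(m, n)) (f : V -> 'M[R]_(n, p)) v D :
  deriv_on S f v D -> deriv_on S (fun x => A *m f x) v (fun d => A *m D d).
Proof.
move=> /(deriv_on_mulmx (deriv_on_cst S A v)).
by apply: eq_deriv_on => // d _; rewrite mul0mx add0r.
Qed.

Lemma deriv_on_mulr m n p (A : 'M[R]_(n, p)) (f : V -> 'M[R]_(m, n)) v D :
  deriv_on S f v D -> deriv_on S (fun x => f x *m A) v (fun d => D d *m A).
Proof.
move=> /deriv_on_mulmx/(_ (deriv_on_cst S A v)).
by apply: eq_deriv_on => // d _; rewrite mulmx0 addr0.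
Qed.

End DerivMore.

(** * Gradients as Frobenius forms, their uniqueness, and symmetrization *)

Section Gradient.
Variable R : realType.
Implicit Types m n : nat.

(** The Frobenius pairing, with values in [R^o] so that the scalars form a normed module to which
    [deriv_on] applies. *)
Definition form m n (G d : 'M[R]_(m, n)) : R^o := \tr (G^T *m d).

Lemma formB m n (G a b : 'M[R]_(m, n)) : form G (a - b) = form G a - form G b.
Proof. by rewrite /form mulmxBr raddfB. Qed.

Lemma formDr m n (G a b : 'M[R]_(m, n)) : form G (a + b) = form G a + form G b.
Proof. by rewrite /form mulmxDr raddfD. Qed.

Lemma formDl m n (G H d : 'M[R]_(m, n)) : form (G + H) d = form G d + form H d.
Proof. by rewrite /form linearD mulmxDl raddfD. Qed.

Lemma formNl m n (G d : 'M[R]_(m, n)) : form (- G) d = - form G d.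
Proof. by rewrite /form linearN mulNmx raddfN. Qed.

Lemma form_mull m n r (A : 'M[R]_(m, n)) (g : 'M[R]_(m, r)) d :
  form g (A *m d) = form (A^T *m g) d.
Proof. by rewrite /form trmx_mul trmxK mulmxA. Qed.

Lemma form_sandwich m n r s (A : 'M[R]_(m, n)) (B : 'M[R]_(r, s)) g d :
  form g (A *m d *m B) = form (A^T *m g *m B^T) d.
Proof. by rewrite /form !trmx_mul !trmxK !mulmxA mxtrace_mulC !mulmxA. Qed.

Lemma form_bounded m n (G : 'M[R]_(m, n)) : norm_bounded (form G).
Proof.
exists (n%:R * (m%:R * `|G^T|)) => d.
rewrite (le_trans (norm_mxtrace _)) // -!mulrA ler_wpM2l //.
exact: mx_norm_mulmx.
Qed.

Lemma form0 m n (G : 'M[R]_(m, n)) : form G 0 = 0.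
Proof. by rewrite /form mulmx0 mxtrace0. Qed.

Lemma is_gradientP m n (S : set 'M[R]_(m, n)) (f : 'M[R]_(m, n) -> R^o) M G :
  is_gradient S f M G <-> S G /\ deriv_on S f M (form G).
Proof.
split=> -[SG fo]; split => //; last by case: fo.
by split => //; apply: bounded_bigO_on (form_bounded G).
Qed.

(** With [H = G' - G], the difference of the two remainders along the admissible increment [t *: H]
    is [t * \tr (H^T *m H)]. Dividing the little-o bound by [t] makes this trace smaller than any
    [e > 0]. *)
Lemma gradient_unique m n (S : set 'M[R]_(m, n)) f M G :
  (forall a b, S a -> S b -> S (a - b)) -> (forall c a, S a -> S (c *: a)) ->
  is_gradient S f M G -> gradient S f M = G.
Proof.
move=> SB SZ fG; apply: xget_unique => // G' [SG' fo']; case: fG => SG fo.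
apply/eqP; rewrite -subr_eq0; apply/eqP; set H := G' - G.
apply: mxtrace_trmul_eq0; apply/eqP; rewrite eq_le mxtrace_trmul_ge0 andbT.
apply/ler_addgt0Pr => e e0; rewrite add0r.
(* Chosen so that [2 e' |H| <= e]; adding 1 to [|H|] covers the case [H = 0]. *)
pose e' := e / (2 * (`|H| + 1)).
have H0 : 0 < `|H| + 1 by rewrite ltr_wpDl.
have e'0 : 0 < e' by rewrite divr_gt0 // mulr_gt0.
have /nbhs_norm0P[h1 /= h10 h1P] := fo _ e'0.
have /nbhs_norm0P[h2 /= h20 h2P] := fo' _ e'0.
pose h := Num.min h1 h2; have h0 : 0 < h by rewrite lt_min h10.
pose t := h / 2 / (`|H| + 1).
have t0 : 0 < t by rewrite !divr_gt0.
have SH : S H by exact: SB.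
have nt : `|t *: H| = t * `|H| by rewrite normrZ gtr0_norm.
have tH : t * `|H| < h.
  have : t * (`|H| + 1) = h / 2 by rewrite /t divfK // gt_eqF.
  by lra.
have /andP[/h1P/(_ (SZ _ _ SH)) d1 /h2P/(_ (SZ _ _ SH)) d2] :
  (`|t *: H| < h1) && (`|t *: H| < h2) by rewrite nt -lt_min.
have : t * \tr (H^T *m H) <= 2 * e' * (t * `|H|).
  have -> : t * \tr (H^T *m H) = (f (M + t *: H) - f M - \tr (G^T *m (t *: H)))
     - (f (M + t *: H) - f M - \tr (G'^T *m (t *: H))).
    have -> : \tr (H^T *m H) = \tr (G'^T *m H) - \tr (G^T *m H).
      by rewrite -raddfB -mulmxBl -linearB.
    by rewrite -!scalemxAr !mxtraceZ; ring.
  rewrite (le_trans (ler_norm _)) // (le_trans (ler_normB _ _)) //.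
  by rewrite -nt mulrDl mul1r mulrDl lerD.
rewrite mulrCA ler_pM2l // => /le_trans; apply.
have : e' * (2 * (`|H| + 1)) = e by rewrite /e' divfK // gt_eqF // mulr_gt0.
by lra.
Qed.

Lemma gradient_unique_setT m n (f : 'M[R]_(m, n) -> R) M G :
  is_gradient setT f M G -> gradient setT f M = G.
Proof. exact: gradient_unique. Qed.

Lemma gradient_unique_symm n (f : 'M[R]_n -> R) M G :
  is_gradient symm_mx f M G -> gradient symm_mx f M = G.
Proof.
apply: gradient_unique => [a b|c a]; rewrite /symm_mx /= => aT.
  by move=> bT; rewrite linearB /= aT bT.
by rewrite linearZ /= aT.
Qed.

(** The representing matrix has as entries the values of [L] on the elementary matrices. *)
Lemma linear_form m n (L : 'M[R]_(m, n) -> R^o) :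
  linear L -> exists G, forall d, L d = form G d.
Proof.
move=> linL; pose L' : {linear 'M[R]_(m, n) -> R^o} :=
  HB.pack L (GRing.isLinear.Build _ _ _ _ L linL).
exists (\matrix_(i, j) L' (delta_mx i j)) => d; rewrite -[L d]/(L' d).
rewrite [in LHS](matrix_sum_delta d) linear_sum /form /mxtrace.
under eq_bigr do rewrite linear_sum.
rewrite exchange_big; apply: eq_bigr => j _; rewrite mxE.
by apply: eq_bigr => i _; rewrite !mxE [LHS](linearZ_LR L') mulrC.
Qed.

Lemma symm_mxD n (A B : 'M[R]_n) : symm_mx A -> symm_mx B -> symm_mx (A + B).
Proof. by rewrite /symm_mx /= => AT BT; rewrite linearD /= AT BT. Qed.

Lemma symm_mxB n (A B : 'M[R]_n) : symm_mx A -> symm_mx B -> symm_mx (A - B).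
Proof. by rewrite /symm_mx /= => AT BT; rewrite linearB /= AT BT. Qed.

Lemma symm_sandwich m n (A : 'M[R]_(m, n)) (P : 'M[R]_n) :
  symm_mx P -> symm_mx (A *m P *m A^T).
Proof. by rewrite /symm_mx /= => PT; rewrite !trmx_mul trmxK PT mulmxA. Qed.

Definition sym_part n (G : 'M[R]_n) := 2^-1 *: G + 2^-1 *: G^T.

Lemma symm_sym_part n (G : 'M[R]_n) : symm_mx (sym_part G).
Proof. by rewrite /symm_mx /= linearD !linearZ /= trmxK addrC. Qed.

(** For symmetric [d], transposing under the trace gives [G] and [G^T] the same pairing with [d].
    This is the source of every factor one half in the recursion. *)
Lemma form_sym_part n (G d : 'M[R]_n) :
  symm_mx d -> form (sym_part G) d = form G d.
Proof.
rewrite /symm_mx /= => dT; rewrite formDl /form !linearZ /= trmxK.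
rewrite -!scalemxAl !mxtraceZ -[X in _ + _ * X]mxtrace_tr trmx_mul dT.
by rewrite [X in _ + _ * X]mxtrace_mulC; lra.
Qed.

End Gradient.

(** * One update step: algebra, differentials and their adjoints *)

Section Update.
Variables (R : realType) (p q : nat) (H : 'M[R]_(q, p)).
Implicit Types (x dx : 'cV[R]_p) (P dP : 'M[R]_p) (M dM : 'M[R]_q).
Implicit Types (y dy : 'cV[R]_q).

(** The update is restated as a function of free arguments, [M] standing for the measurement noise
    covariance. These definitions are convertible with [innovation_cov], [gain] and [kf_update]. *)
Definition icov P M := H *m P *m H^T + M.
Definition kgain P M := P *m H^T *m invmx (icov P M).
Definition xup x P M y := x + kgain P M *m (y - H *m x).
Definition Pup P M := (1%:M - kgain P M *m H) *m P.

Definition dgain P M dP dM :=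
  (1%:M - kgain P M *m H) *m dP *m H^T *m invmx (icov P M)
  - kgain P M *m dM *m invmx (icov P M).
Definition dxup x P M y dx dP dM dy :=
  dx + (dgain P M dP dM *m (y - H *m x) + kgain P M *m (dy - H *m dx)).
(** Linear in [(dP, dM)] with the gain frozen. Evaluated at [(P, M)] itself, it is Joseph's form of
    the posterior covariance. *)
Definition dPup P M dP dM :=
  (1%:M - kgain P M *m H) *m dP *m (1%:M - kgain P M *m H)^T
  + kgain P M *m dM *m (kgain P M)^T.

Lemma trmx_icov P M : symm_mx P -> symm_mx M -> symm_mx (icov P M).
Proof.
rewrite /symm_mx /= => PT MT.
by rewrite linearD /= !trmx_mul trmxK MT PT mulmxA.
Qed.

Lemma trmx_kgain P M : symm_mx P -> symm_mx M ->
  (kgain P M)^T = invmx (icov P M) *m H *m P.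
Proof.
move=> PT MT; rewrite !trmx_mul trmxK trmx_inv (trmx_icov PT MT) PT.
by rewrite mulmxA.
Qed.

(** Here [K H P = P H^T S^-1 H P]. The lemma covers perturbed symmetric arguments as well, so it
    makes the increment of the update admissible. *)
Lemma symm_Pup P M : symm_mx P -> symm_mx M -> symm_mx (Pup P M).
Proof.
move=> PT MT; rewrite /symm_mx /= /Pup mulmxBl mul1mx linearB /= PT.
congr (_ - _); rewrite trmx_mul (trmx_mul _ H) trmx_kgain // PT.
by rewrite /kgain !mulmxA.
Qed.

(* Joseph's form, in which positivity of the posterior covariance is visible. *)
Lemma Pup_joseph P M : symm_mx P -> symm_mx M -> icov P M \in unitmx ->
  Pup P M = dPup P M P M.
Proof.
move=> PT MT uS; rewrite /dPup /Pup; set K := kgain P M.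
have KS : K *m icov P M = P *m H^T by rewrite mulmxKV.
rewrite [(_ - _)^T]linearB /= trmx1 mulmxBr mulmx1 -[LHS]addr0 -addrA.
congr (_ + _); apply/eqP; rewrite eq_sym addrC subr_eq0; apply/eqP.
rewrite (trmx_mul K H) mulmxA; congr (_ *m _).
(* Since [K S = P H^T], this turns [K M] into [(1 - K H) P H^T], cancelling the cross term. *)
have -> : K *m M = K *m (icov P M - H *m P *m H^T) by rewrite addrC addKr.
by rewrite mulmxBr KS mulmxBl mul1mx mulmxBl !mulmxA.
Qed.

(** Multiply by [M = S - H P H^T] on the left: [M S^-1 H = H - H P H^T S^-1 H = H (1 - K H)]. *)
Lemma invmx_icov_mul P M : icov P M \in unitmx -> M \in unitmx ->
  invmx (icov P M) *m H = invmx M *m H *m (1%:M - kgain P M *m H).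
Proof.
move=> uS uM; apply: (can_inj (mulKmx uM)); rewrite -!mulmxA mulKVmx //.
have {1}-> : M = icov P M - H *m P *m H^T by rewrite addrC addKr.
by rewrite mulmxBl mulKVmx // mulmxBr mulmx1 /kgain !mulmxA.
Qed.

Section Deriv.
Variables (V : normedModType R) (S : set V) (v : V).
Variables (fx : V -> 'cV[R]_p) (fP : V -> 'M[R]_p) (fM : V -> 'M[R]_q).
Variables (fy : V -> 'cV[R]_q).
Variables (Dx : V -> 'cV[R]_p) (DP : V -> 'M[R]_p) (DM : V -> 'M[R]_q).
Variables (Dy : V -> 'cV[R]_q).
Hypotheses (dfx : deriv_on S fx v Dx) (dfP : deriv_on S fP v DP).
Hypotheses (dfM : deriv_on S fM v DM) (dfy : deriv_on S fy v Dy).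
Hypothesis uS : icov (fP v) (fM v) \in unitmx.

(** The product and inverse rules give [dP H^T S^-1 - P H^T S^-1 (H dP H^T + dM) S^-1]; recognizing
    [K = P H^T S^-1] collects the [dP] terms behind [1 - K H]. *)
Lemma deriv_on_kgain : deriv_on S (fun w => kgain (fP w) (fM w)) v
  (fun d => dgain (fP v) (fM v) (DP d) (DM d)).
Proof.
have dS : deriv_on S (fun w => icov (fP w) (fM w)) v
    (fun d => H *m DP d *m H^T + DM d).
  by apply: deriv_onD dfM; apply: deriv_on_mulr; apply: deriv_on_mull.
have dY := deriv_on_invmx (f := fun w => icov (fP w) (fM w)) uS dS.
have := deriv_on_mulmx (deriv_on_mulr H^T dfP) dY.
apply: eq_deriv_on => // d _; rewrite /dgain.
set Y := invmx _; rewrite mulmxN !mulmxA -/(kgain (fP v) (fM v)).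
by rewrite mulmxDr !mulmxDl opprD addrA mul1mx !mulNmx !mulmxA.
Qed.

Lemma deriv_on_xup : deriv_on S (fun w => xup (fx w) (fP w) (fM w) (fy w)) v
  (fun d => dxup (fx v) (fP v) (fM v) (fy v) (Dx d) (DP d) (DM d) (Dy d)).
Proof.
apply: deriv_onD => //; apply: deriv_on_mulmx; first exact: deriv_on_kgain.
by apply: deriv_onD => //; apply: deriv_onN; apply: deriv_on_mull.
Qed.

(** The product rule gives [(1 - K H) dP - dK H P]. Symmetry of [P] and [M] turns [S^-1 H P] into
    [K^T], which completes both sandwiches. *)
Lemma deriv_on_Pup : symm_mx (fP v) -> symm_mx (fM v) ->
  deriv_on S (fun w => Pup (fP w) (fM w)) v
    (fun d => dPup (fP v) (fM v) (DP d) (DM d)).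
Proof.
move=> PT MT.
have dKH : deriv_on S (fun w => 1%:M - kgain (fP w) (fM w) *m H) v
    (fun d => - (dgain (fP v) (fM v) (DP d) (DM d) *m H)).
  have := deriv_onD (deriv_on_cst S 1%:M v)
            (deriv_onN (deriv_on_mulr H deriv_on_kgain)).
  by apply: eq_deriv_on => // d _; rewrite add0r.
apply: eq_deriv_on (deriv_on_mulmx dKH dfP) => // d _.
rewrite /dPup /dgain; set K := kgain _ _; set Y := invmx _.
rewrite [in RHS]linearB /= trmx1 trmx_mul [K^T]trmx_kgain // -/Y.
set A := 1%:M - _; rewrite [in RHS]mulmxBr mulmx1 mulmxBl opprB mulmxBl.
by rewrite !mulmxA addrC addrA addrAC -addrA.
Qed.

End Deriv.

(** The adjoint of [dxup]: each coefficient is what the gradient [gx] of the posterior state sends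
    back to one input, symmetrized for the two covariances. *)
Lemma form_dxup x P M y dx dP dM dy gx :
  symm_mx P -> symm_mx M -> symm_mx dP -> symm_mx dM ->
  icov P M \in unitmx -> M \in unitmx ->
  let K := kgain P M in let z := y - H *m x in
  form gx (dxup x P M y dx dP dM dy)
  = form ((1%:M - K *m H)^T *m gx) dx
    + form ((1%:M - K *m H)^T *m (2^-1 *: (gx *m z^T *m invmx M *m H)
         + 2^-1 *: (H^T *m invmx M *m z *m gx^T)) *m (1%:M - K *m H)) dP
    - form (2^-1 *: (K^T *m gx *m z^T *m invmx (icov P M))
         + 2^-1 *: (invmx (icov P M) *m z *m gx^T *m K)) dM
    + form (K^T *m gx) dy.
Proof.
move=> PT MT dPT dMT uS uM K z.
have YT : (invmx (icov P M))^T = invmx (icov P M).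
  by rewrite trmx_inv (trmx_icov PT MT).
have MiT : (invmx M)^T = invmx M by rewrite trmx_inv MT.
have -> : dxup x P M y dx dP dM dy
  = (1%:M - K *m H) *m dx + (1%:M - K *m H) *m dP *m H^T *m invmx (icov P M) *m z
    - K *m dM *m invmx (icov P M) *m z + K *m dy.
  have reorder (a b c d e : 'cV[R]_p) : a + (b - c + (d - e)) = a - e + b - c + d.
    by apply/matrixP => i j; rewrite !mxE; ring.
  rewrite /dxup /dgain -/K -/z (mulmxBr K dy) (mulmxBl _ _ z) [X in _ = X + _ - _ + _]mulmxBl.
  by rewrite mul1mx reorder [K *m (H *m dx)]mulmxA.
rewrite formDr formB formDr -/z.
congr (_ + _ - _ + _); [exact: form_mull | | | exact: form_mull].
(* The raw coefficient of [dP] is [A^T gx z^T S^-1 H] with [A = 1 - K H]; after symmetrization,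
   [S^-1 H = M^-1 H A] supplies the outer factor [A] on the right. *)
- rewrite -2!mulmxA form_sandwich -(form_sym_part _ dPT); congr (form _ _).
  rewrite !trmx_mul YT trmxK /sym_part.
  rewrite -(mulmxA z^T) invmx_icov_mul // -/K; set A := 1%:M - _.
  clearbody A z; rewrite !mulmxA !trmx_mul !trmxK MiT.
  by rewrite mulmxDr mulmxDl -!(scalemxAr, scalemxAl) !mulmxA.
- rewrite -mulmxA form_sandwich -(form_sym_part _ dMT); congr (form _ _).
  by rewrite /sym_part !trmx_mul !trmxK YT !mulmxA.
Qed.

Lemma form_dPup P M dP dM (G : 'M[R]_p) :
  let K := kgain P M in
  form G (dPup P M dP dM)
  = form ((1%:M - K *m H)^T *m G *m (1%:M - K *m H)) dP
    + form (K^T *m G *m K) dM.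
Proof.
by move=> K; rewrite formDr !form_sandwich !trmxK.
Qed.

End Update.

(** * Positivity of the covariances along the unperturbed filter *)

Section Positive.
Variable R : realType.
Implicit Types n : nat.

Lemma pd_psd n (A : 'M[R]_n) : pd_mx A -> psd_mx A.
Proof.
move=> [AT A0]; split => // v; have [->|/A0/ltW//] := eqVneq v 0.
by rewrite mulmx0 mxE.
Qed.

Lemma psd_mxD n (A B : 'M[R]_n) : psd_mx A -> psd_mx B -> psd_mx (A + B).
Proof.
move=> [AT A0] [BT B0]; split => [|v]; first by rewrite linearD /= AT BT.
by rewrite mulmxDr mulmxDl mxE addr_ge0.
Qed.

Lemma psd_pd_mxD n (A B : 'M[R]_n) : psd_mx A -> pd_mx B -> pd_mx (A + B).
Proof.
move=> [AT A0] [BT B0]; split => [|v v0]; first by rewrite linearD /= AT BT.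
by rewrite mulmxDr mulmxDl mxE ltr_wpDl // B0.
Qed.

Lemma psd_sandwich m n (A : 'M[R]_(m, n)) (P : 'M[R]_n) :
  psd_mx P -> psd_mx (A *m P *m A^T).
Proof.
move=> [PT P0]; split => [|v]; first by rewrite !trmx_mul trmxK PT mulmxA.
by have := P0 (A^T *m v); rewrite trmx_mul trmxK !mulmxA.
Qed.

Lemma pd_unitmx n (A : 'M[R]_n) : pd_mx A -> A \in unitmx.
Proof.
move=> [AT A0]; rewrite -row_free_unit -kermx_eq0; apply/eqP/row_matrixP => i.
rewrite row0; set v := row i _.
have /sub_kermxP vA : (v <= kermx A)%MS by exact: row_sub.
apply/eqP; apply: contraT => v0.
have := A0 v^T; rewrite trmxK vA mul0mx mxE ltxx => -> //.
by apply: contra v0 => /eqP/(congr1 trmx); rewrite trmxK trmx0 => ->.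
Qed.

Lemma psd_icov p q (H : 'M[R]_(q, p)) P M :
  psd_mx P -> pd_mx M -> icov H P M \in unitmx.
Proof. by move=> Pp Mp; apply/pd_unitmx/psd_pd_mxD => //; exact: psd_sandwich. Qed.

Lemma psd_Pup p q (H : 'M[R]_(q, p)) P M :
  psd_mx P -> pd_mx M -> psd_mx (Pup H P M).
Proof.
move=> Pp Mp; rewrite Pup_joseph ?psd_icov //; try by case: Pp; try by case: Mp.
by apply: psd_mxD; apply: psd_sandwich => //; exact: pd_psd.
Qed.

End Positive.

Section Filter.
Variables (R : realType) (dx dy du : nat -> nat) (k : kalman R dx dy du).
Variable N : nat.
Hypotheses (hP0 : psd_mx (kP0 k))
  (hQ : forall n, (1 <= n <= N)%N -> psd_mx (kQ k n))
  (hR : forall n, (1 <= n <= N)%N -> pd_mx (kR k n)).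

Lemma psd_kf_predict n (s : kf_state R dx n) : (n < N)%N ->
  psd_mx s.2 -> psd_mx (kf_predict k (n := n.+1) s).2.
Proof. by move=> nN sp; apply: psd_mxD; [exact: psd_sandwich|exact: hQ]. Qed.

Lemma psd_kf_post n : (n <= N)%N -> psd_mx (kf_post k n).2.
Proof.
elim: n => [//|n IHn] nN; apply: psd_Pup; last exact: hR.
by apply: psd_kf_predict => //; exact/IHn/ltnW.
Qed.

Lemma psd_kf_pred n : (n < N)%N -> psd_mx (kf_pred k n.+1).2.
Proof. by move=> nN; apply: psd_kf_predict => //; exact/psd_kf_post/ltnW. Qed.

End Filter.

(** * The loss as a tail sum, and linear forms for the given losses *)

Section Tail.
Variables (R : realType) (dx dy du : nat -> nat) (l : kalman_loss R dx dy).

Lemma loss_tail (k : kalman R dx dy du) N :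
  loss k l N = tail_loss k l N (kf_post k 0).
Proof.
(* The start [n] is generalized because each unfolding of [tail_loss] moves it one step forward. *)
suff gen j n : tail_loss k l j (kf_post k n)
    = \sum_(n.+1 <= m < (n + j).+1) (lpost l m (kf_post k m)
        + lpred l m ((kf_pred k m).1, (kf_pred k m).2, kR k m, ky k m)).
  by rewrite gen.
elim: j n => [|j IHj] n; first by rewrite addn0 big_geq.
rewrite big_ltn ?addnS ?ltnS ?leq_addr //=.
by rewrite (IHj n.+1) addSn [X in X + _]addrC.
Qed.

(** A parametrized filter at its base point agrees with [k] only on the steps [1..N], so the two
    records need not be equal; only the steps actually run are compared. *)
Lemma tail_loss_ext (k : kalman R dx dy du) Q M y j n s :
  (forall m, (n < m <= n + j)%N -> [/\ Q m = kQ k m, M m = kR k m & y m = ky k m]) ->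
  tail_loss (Kalman (kF k) (kB k) (kH k) (ku k) Q M y (kx0 k) (kP0 k)) l j (n := n) s
  = tail_loss k l j s.
Proof.
elim: j n s => [//|j IHj] n s ext.
have [Qn Mn yn] : [/\ Q n.+1 = kQ k n.+1, M n.+1 = kR k n.+1 & y n.+1 = ky k n.+1].
  by apply: ext; rewrite ltnSn addnS ltnS leq_addr.
rewrite /= IHj => [|m /andP[nm mj]]; last first.
  by apply: ext; rewrite addnS -addSn mj (ltnW nm).
rewrite /kf_predict /kf_update /gain /innovation_cov /innovation /=.
by rewrite Qn Mn yn.
Qed.

End Tail.

Section LossGradient.
Variable R : realType.

(** Restricting the differential to each component gives one form per component; on admissible
    increments the matrix form may be replaced by its symmetric part. *)
Lemma differentiable_in_form2 p (f : 'cV[R]_p * 'M[R]_p -> R) S a :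
  (forall v, S v <-> symm_mx v.2) -> differentiable_in S f a ->
  exists gx gP, symm_mx gP /\
    deriv_on S (f : _ -> R^o) a (fun d => form gx d.1 + form gP d.2).
Proof.
move=> SP [D [_ fo]].
have [gx Dx] : exists G, forall d, D (d, 0) = form G d.
  apply: (@linear_form _ _ _ (fun d => D (d, 0))) => c u w.
  by rewrite -linearP; congr (D _); congr pair; rewrite /= scaler0 addr0.
have [gP DP] : exists G, forall d, D (0, d) = form G d.
  apply: (@linear_form _ _ _ (fun d => D (0, d))) => c u w.
  by rewrite -linearP; congr (D _); congr pair; rewrite /= scaler0 addr0.
exists gx, (sym_part gP); split; first exact: symm_sym_part.
split.
  apply: bounded_bigO_on; apply: norm_boundedD.
    exact: norm_bounded_comp (norm_bounded_fst _ _) (form_bounded _).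
  exact: norm_bounded_comp (norm_bounded_snd _ _) (form_bounded _).
move: fo; apply: eq_littleo_on => -[dx dP] /SP/= dPT.
rewrite form_sym_part // -Dx -DP -raddfD; congr (_ - D (_, _)).
  by rewrite /= addr0.
by rewrite /= add0r.
Qed.

Lemma differentiable_in_form4 p q
    (f : 'cV[R]_p * 'M[R]_p * 'M[R]_q * 'cV[R]_q -> R) S a :
  (forall v, S v <-> symm_mx v.1.1.2 /\ symm_mx v.1.2) ->
  differentiable_in S f a ->
  exists gx gP gM gy, [/\ symm_mx gP, symm_mx gM &
    deriv_on S (f : _ -> R^o) a (fun d =>
      form gx d.1.1.1 + form gP d.1.1.2 + form gM d.1.2 + form gy d.2)].
Proof.
move=> SP [D [_ fo]].
have [gx Dx] : exists G, forall d, D (d, 0, 0, 0) = form G d.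
  apply: (@linear_form _ _ _ (fun d => D (d, 0, 0, 0))) => c u w.
  by rewrite -linearP; congr (D _); do 3?[congr pair]; rewrite /= scaler0 addr0.
have [gP DP] : exists G, forall d, D (0, d, 0, 0) = form G d.
  apply: (@linear_form _ _ _ (fun d => D (0, d, 0, 0))) => c u w.
  by rewrite -linearP; congr (D _); do 3?[congr pair]; rewrite /= scaler0 addr0.
have [gM DM] : exists G, forall d, D (0, 0, d, 0) = form G d.
  apply: (@linear_form _ _ _ (fun d => D (0, 0, d, 0))) => c u w.
  by rewrite -linearP; congr (D _); do 3?[congr pair]; rewrite /= scaler0 addr0.
have [gy Dy] : exists G, forall d, D (0, 0, 0, d) = form G d.
  apply: (@linear_form _ _ _ (fun d => D (0, 0, 0, d))) => c u w.
  by rewrite -linearP; congr (D _); do 3?[congr pair]; rewrite /= scaler0 addr0.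
exists gx, (sym_part gP), (sym_part gM), gy; split; try exact: symm_sym_part.
split.
  apply: bounded_bigO_on; do 3?[apply: norm_boundedD].
  - apply: norm_bounded_comp (form_bounded _).
    apply: norm_bounded_comp (norm_bounded_fst _ _).
    by apply: norm_bounded_comp (norm_bounded_fst _ _); exact: norm_bounded_fst.
  - apply: norm_bounded_comp (form_bounded _).
    apply: norm_bounded_comp (norm_bounded_snd _ _).
    by apply: norm_bounded_comp (norm_bounded_fst _ _); exact: norm_bounded_fst.
  - apply: norm_bounded_comp (form_bounded _).
    by apply: norm_bounded_comp (norm_bounded_snd _ _); exact: norm_bounded_fst.
  - exact: norm_bounded_comp (norm_bounded_snd _ _) (form_bounded _).
move: fo; apply: eq_littleo_on => -[[[dx dP] dM] dy] /SP/= [dPT dMT].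
rewrite !form_sym_part // -Dx -DP -DM -Dy -!raddfD.
by congr (_ - D (_, _, _, _)); rewrite /= !(addr0, add0r).
Qed.

End LossGradient.

(** The base value [w] is separate from [f v] because it is usually equal to it only
    propositionally, as for an overridden family. Compatibility with differences is the form of
    additivity that [deriv_on_comp] consumes. *)
Definition affine_at (R : realType) (V W : normedModType R) (f : V -> W)
    (v : V) (w : W) (D : V -> W) : Prop :=
  [/\ forall d, f (v + d) = w + D d, forall a b, D (a - b) = D a - D b
    & norm_bounded D].

Section Affine.
Variables (R : realType) (V W : normedModType R).
Variables (f : V -> W) (v : V) (w : W) (D : V -> W).
Hypothesis fD : affine_at f v w D.

Lemma affine_at_D0 : D 0 = 0.
Proof. by case: fD => _ DB _; rewrite -(subr0 0) DB subrr. Qed.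

Lemma affine_at_val : f v = w.
Proof. by case: fD => fE _ _; rewrite -[v]addr0 fE affine_at_D0 addr0. Qed.

Lemma affine_at_deriv S : deriv_on S f v D.
Proof.
case: (fD) => fE _ Db; apply: deriv_on_affine Db => d.
by rewrite fE affine_at_val.
Qed.

End Affine.

(** Extracts a partial gradient from a joint differential: [i] inserts a matrix into a tuple with
    frozen other components, and [i0] is its linear part. *)
Lemma is_gradient_pullback (R : realType) (W : normedModType R) m n
    (S : set 'M[R]_(m, n)) (T : set W) (g : W -> R) E
    (i i0 : 'M[R]_(m, n) -> W) M G :
  deriv_on T (g : W -> R^o) (i M) E -> S G ->
  (forall d, i (M + d) = i M + i0 d) -> (forall d, `|i0 d| <= `|d|) ->
  (forall d, S d -> T (i0 d)) -> (forall d, E (i0 d) = form G d) ->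
  is_gradient S (fun x => g (i x)) M G.
Proof.
move=> dg SG iD i01 iS EG; apply/is_gradientP; split => //.
by apply: eq_deriv_on (deriv_on_pullback iD i01 iS dg).
Qed.

(** * The backward recursion with data depending on a parameter *)

Section Param.
Variables (R : realType) (dx dy du : nat -> nat) (N : nat).
Variables (k : kalman R dx dy du) (l : kalman_loss R dx dy).
Hypotheses (hP0 : psd_mx (kP0 k))
  (hQ : forall n, (1 <= n <= N)%N -> psd_mx (kQ k n))
  (hR : forall n, (1 <= n <= N)%N -> pd_mx (kR k n)).

Let postS n := [set a : 'cV[R]_(dx n) * 'M[R]_(dx n) | symm_mx a.2].
Let predS n := [set a : 'cV[R]_(dx n) * 'M[R]_(dx n) * 'M[R]_(dy n)
                      * 'cV[R]_(dy n) | symm_mx a.1.1.2 /\ symm_mx a.1.2].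

Hypotheses (hlpred : forall n, (1 <= n <= N)%N ->
    differentiable_in (@predS n) (lpred l n)
      ((kf_pred k n).1, (kf_pred k n).2, kR k n, ky k n))
  (hlpost : forall n, (n <= N)%N ->
    differentiable_in (@postS n) (lpost l n) (kf_post k n)).

(** Joint differentiability provides some coefficients; uniqueness of the partial gradients
    identifies them with [dlpost_x] and [dlpost_P]. *)
Lemma is_gradient_lpost n : (n <= N)%N ->
  let x := (kf_post k n).1 in let P := (kf_post k n).2 in
  [/\ is_gradient setT (fun x' => lpost l n (x', P)) x (dlpost_x k l n),
      is_gradient symm_mx (fun P' => lpost l n (x, P')) P (dlpost_P k l n)
    & deriv_on (@postS n) (lpost l n : _ -> R^o) (x, P)
        (fun d => form (dlpost_x k l n) d.1 + form (dlpost_P k l n) d.2)].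
Proof.
move=> nN; have := hlpost nN.
rewrite /dlpost_x /dlpost_P; case: (kf_post k n) => x P /= hl.
have [//|gx [gP [gPT dl]]] := differentiable_in_form2 _ hl.
have Gx : is_gradient setT (fun x' => lpost l n (x', P)) x gx.
  apply: (is_gradient_pullback (i0 := fun d => (d, 0)) dl) => // d.
  - by congr pair; rewrite addr0.
  - exact: norm_pairr0.
  - by move=> _; exact: trmx0.
  - by rewrite /= form0 addr0.
have GP : is_gradient symm_mx (fun P' => lpost l n (x, P')) P gP.
  apply: (is_gradient_pullback (i0 := fun d => (0, d)) dl) => // d.
  - by congr pair; rewrite addr0.
  - exact: norm_pair0r.
  - by rewrite /= form0 add0r.
by rewrite (gradient_unique_setT Gx) (gradient_unique_symm GP).
Qed.

Lemma is_gradient_lpred n : (1 <= n <= N)%N ->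
  let x := (kf_pred k n).1 in let P := (kf_pred k n).2 in
  [/\ is_gradient setT (fun x' => lpred l n (x', P, kR k n, ky k n)) x
        (dlpred_x k l n),
      is_gradient symm_mx (fun P' => lpred l n (x, P', kR k n, ky k n)) P
        (dlpred_P k l n),
      is_gradient symm_mx (fun M' => lpred l n (x, P, M', ky k n)) (kR k n)
        (dlpred_R k l n),
      is_gradient setT (fun y' => lpred l n (x, P, kR k n, y')) (ky k n)
        (dlpred_y k l n)
    & deriv_on (@predS n) (lpred l n : _ -> R^o) (x, P, kR k n, ky k n)
        (fun d => form (dlpred_x k l n) d.1.1.1 + form (dlpred_P k l n) d.1.1.2
          + form (dlpred_R k l n) d.1.2 + form (dlpred_y k l n) d.2)].
Proof.
move=> nN; have := hlpred nN.
rewrite /dlpred_x /dlpred_P /dlpred_R /dlpred_y.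
case: (kf_pred k n) => x P /= hl.
have [//|gx [gP [gM [gy [gPT gMT dl]]]]] := differentiable_in_form4 _ hl.
have Gx : is_gradient setT (fun x' => lpred l n (x', P, kR k n, ky k n)) x gx.
  apply: (is_gradient_pullback (i0 := fun d => (d, 0, 0, 0)) dl) => // d.
  - by do 3?[congr pair]; rewrite addr0.
  - by rewrite !(le_trans (norm_pairr0 _ _)).
  - by move=> _; split; exact: trmx0.
  - by rewrite /= !form0 !addr0.
have GP : is_gradient symm_mx (fun P' => lpred l n (x, P', kR k n, ky k n)) P gP.
  apply: (is_gradient_pullback (i0 := fun d => (0, d, 0, 0)) dl) => // d.
  - by do 3?[congr pair]; rewrite addr0.
  - by do 2!rewrite (le_trans (norm_pairr0 _ _)) //; exact: norm_pair0r.
  - by move=> dT; split => //; exact: trmx0.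
  - by rewrite /= !form0 !addr0 add0r.
have GM : is_gradient symm_mx (fun M' => lpred l n (x, P, M', ky k n)) (kR k n) gM.
  apply: (is_gradient_pullback (i0 := fun d => (0, 0, d, 0)) dl) => // d.
  - by do 3?[congr pair]; rewrite addr0.
  - by rewrite (le_trans (norm_pairr0 _ _)) //; exact: norm_pair0r.
  - by move=> dT; split => //; exact: trmx0.
  - by rewrite /= !form0 !addr0 !add0r.
have Gy : is_gradient setT (fun y' => lpred l n (x, P, kR k n, y')) (ky k n) gy.
  apply: (is_gradient_pullback (i0 := fun d => (0, 0, 0, d)) dl) => // d.
  - by do 3?[congr pair]; rewrite addr0.
  - exact: norm_pair0r.
  - by move=> _; split; exact: trmx0.
  - by rewrite /= !form0 !add0r.
by rewrite (gradient_unique_setT Gx) (gradient_unique_symm GP)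
  (gradient_unique_symm GM) (gradient_unique_setT Gy).
Qed.

Let K n := gain k (kf_pred k n).
Let z n := innovation k (kf_pred k n).
Let Y n := invmx (innovation_cov k (kf_pred k n)).
Let A n : 'M[R]_(dx n) := 1%:M - K n *m kH k n.

(** The four [rec_] definitions here are right-hand sides of the theorem. They involve no [t], so
    different choices of parameter yield the same coefficients. *)
Definition rec_xpred n := (A n)^T *m dL_xpost k l N n + dlpred_x k l n.

Definition rec_Ppred n :=
  (A n)^T *m (dL_Ppost k l N n
    + 2^-1 *: (dL_xpost k l N n *m (z n)^T *m invmx (kR k n) *m kH k n)
    + 2^-1 *: ((kH k n)^T *m invmx (kR k n) *m z n *m (dL_xpost k l N n)^T))
  *m A n + dlpred_P k l n.

Definition rec_R n :=
  (K n)^T *m dL_Ppost k l N n *m K n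
  - 2^-1 *: ((K n)^T *m dL_xpost k l N n *m (z n)^T *m Y n)
  - 2^-1 *: (Y n *m z n *m (dL_xpost k l N n)^T *m K n) + dlpred_R k l n.

Definition rec_y n := (K n)^T *m dL_xpost k l N n + dlpred_y k l n.

Section Theta.
Variables (Th : normedModType R) (ST : set Th) (th0 : Th).
Variables (Qf : Th -> forall n, 'M[R]_(dx n)) (DQ : forall n, Th -> 'M[R]_(dx n)).
Variables (Mf : Th -> forall n, 'M[R]_(dy n)) (DM : forall n, Th -> 'M[R]_(dy n)).
Variables (yf : Th -> forall n, 'cV[R]_(dy n)) (Dy : forall n, Th -> 'cV[R]_(dy n)).
Hypotheses (ST0 : ST 0)
  (aQ : forall n, (1 <= n <= N)%N -> affine_at (fun t => Qf t n) th0 (kQ k n) (DQ n))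
  (aM : forall n, (1 <= n <= N)%N -> affine_at (fun t => Mf t n) th0 (kR k n) (DM n))
  (ay : forall n, (1 <= n <= N)%N -> affine_at (fun t => yf t n) th0 (ky k n) (Dy n))
  (DQT : forall n t, ST t -> symm_mx (DQ n t))
  (DMT : forall n t, ST t -> symm_mx (DM n t)).

Let kk t := Kalman (kF k) (kB k) (kH k) (ku k) (Qf t) (Mf t) (yf t) (kx0 k) (kP0 k).

(* The contribution to the differential of the loss of the dependence of the
   data of step [n] on [t]. *)
Definition step_form n t : R^o :=
  form (rec_y n) (Dy n t) + form (rec_Ppred n) (DQ n t) + form (rec_R n) (DM n t).

Definition tail_form n t : R^o := \sum_(n.+1 <= m < N.+1) step_form m t.

Lemma step_formB n a b : (1 <= n <= N)%N ->
  step_form n (a - b) = step_form n a - step_form n b.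
Proof.
move=> nN; case: (aQ nN) (aM nN) (ay nN) => _ QB _ [_ MB _] [_ yB _].
by rewrite /step_form QB MB yB !formB; ring.
Qed.

Lemma tail_formB n a b : tail_form n (a - b) = tail_form n a - tail_form n b.
Proof.
rewrite /tail_form -sumrB big_nat [RHS]big_nat; apply: eq_bigr => m /andP[nm mN].
by apply: step_formB; rewrite (leq_trans _ nm).
Qed.

Lemma step_form_bounded n : (1 <= n <= N)%N -> norm_bounded (step_form n).
Proof.
move=> nN; case: (aQ nN) (aM nN) (ay nN) => _ _ Qb [_ _ Mb] [_ _ yb].
by apply: norm_boundedD; [apply: norm_boundedD|];
  apply: norm_bounded_comp (form_bounded _).
Qed.

Lemma tail_form_bounded n : norm_bounded (tail_form n).
Proof.
apply: norm_bounded_sum => m; rewrite mem_index_iota => /andP[nm mN].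
by apply: step_form_bounded; rewrite (leq_trans _ nm).
Qed.

Definition stateS n := [set v : 'cV[R]_(dx n) * 'M[R]_(dx n) * Th |
  symm_mx v.1.2 /\ ST v.2].
Arguments stateS n : clear implicits.

Lemma deriv_on_state_proj n (v : 'cV[R]_(dx n) * 'M[R]_(dx n) * Th) :
  [/\ deriv_on (stateS n) (fun v => v.1.1) v (fun d => d.1.1),
      deriv_on (stateS n) (fun v => v.1.2) v (fun d => d.1.2)
    & deriv_on (stateS n) (fun v => v.2) v (fun d => d.2)].
Proof.
split; apply: deriv_on_affine => //.
- by apply: norm_bounded_comp (norm_bounded_fst _ _); exact: norm_bounded_fst.
- by apply: norm_bounded_comp (norm_bounded_snd _ _); exact: norm_bounded_fst.
- exact: norm_bounded_snd.
Qed.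

Lemma deriv_on_theta n (s : 'cV[R]_(dx n) * 'M[R]_(dx n))
    (W : normedModType R) (f : Th -> W) w E : affine_at f th0 w E ->
  deriv_on (stateS n) (fun v => f v.2) (s, th0) (fun d => E d.2).
Proof.
move=> /affine_at_deriv/(_ ST) df.
apply: (deriv_on_pullback (i0 := snd) _ _ _ df) => //= d.
- exact: norm_snd_le.
- by case.
Qed.

Definition state_form n (gx : 'cV[R]_(dx n)) (gP : 'M[R]_(dx n)) (h : Th -> R^o)
    (d : 'cV[R]_(dx n) * 'M[R]_(dx n) * Th) : R^o :=
  form gx d.1.1 + form gP d.1.2 + h d.2.

Lemma state_formB n (gx : 'cV[R]_(dx n)) gP h a b :
  (forall a b, h (a - b) = h a - h b) ->
  state_form gx gP h (a - b) = state_form gx gP h a - state_form gx gP h b.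
Proof. by move=> hB; rewrite /state_form hB !formB; ring. Qed.

Lemma state_form_bounded n (gx : 'cV[R]_(dx n)) gP h :
  norm_bounded h -> norm_bounded (state_form gx gP h).
Proof.
move=> hb; apply: norm_boundedD; first apply: norm_boundedD.
- apply: norm_bounded_comp (form_bounded _).
  by apply: norm_bounded_comp (norm_bounded_fst _ _); exact: norm_bounded_fst.
- apply: norm_bounded_comp (form_bounded _).
  by apply: norm_bounded_comp (norm_bounded_snd _ _); exact: norm_bounded_fst.
- exact: norm_bounded_comp (norm_bounded_snd _ _) hb.
Qed.

Lemma state_gradient n (f : 'cV[R]_(dx n) * 'M[R]_(dx n) * Th -> R)
    (s : 'cV[R]_(dx n) * 'M[R]_(dx n)) gx gP (h : Th -> R^o) :
  h 0 = 0 -> symm_mx gP ->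
  deriv_on (stateS n) (f : _ -> R^o) (s, th0) (state_form gx gP h) ->
  is_gradient setT (fun x' => f (x', s.2, th0)) s.1 gx /\
  is_gradient symm_mx (fun P' => f (s.1, P', th0)) s.2 gP.
Proof.
case: s => x P h0 gPT df; split.
  apply: (is_gradient_pullback (i0 := fun d => (d, 0, 0)) df) => // d.
  - by do 2?[congr pair]; rewrite addr0.
  - by rewrite !(le_trans (norm_pairr0 _ _)).
  - by move=> _; split => //; exact: trmx0.
  - by rewrite /state_form /= h0 form0 !addr0.
apply: (is_gradient_pullback (i0 := fun d => (0, d, 0)) df) => // d.
- by do 2?[congr pair]; rewrite addr0.
- by rewrite (le_trans (norm_pairr0 _ _)) //; exact: norm_pair0r.
- by rewrite /state_form /= h0 form0 addr0 add0r.
Qed.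

(** The induction invariant. The first two parts certify that the chosen values [dL_xpost] and
    [dL_Ppost] are genuine gradients; the third is the joint differential used by the chain rule. *)
Definition post_claim n :=
  [/\ is_gradient setT (L_xpost k l N n) (kf_post k n).1 (dL_xpost k l N n),
      is_gradient symm_mx (L_Ppost k l N n) (kf_post k n).2 (dL_Ppost k l N n)
    & deriv_on (stateS n)
        ((fun v => loss_from_post (kk v.2) l N n v.1) : _ -> R^o)
        (kf_post k n, th0)
        (state_form (dL_xpost k l N n) (dL_Ppost k l N n) (tail_form n))].

(** At step [n] itself [t] acts only through [y_n] and [R_n]: the noise [Q_n] is already absorbed in
    the predicted covariance. *)
Definition pred_claim n :=
  deriv_on (stateS n)
    ((fun v => loss_from_pred (kk v.2) l N n v.1) : _ -> R^o)
    (kf_pred k n, th0)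
    (state_form (dL_xpred k l N n) (dL_Ppred k l N n)
      (fun t => form (rec_y n) (Dy n t) + form (rec_R n) (DM n t)
                + tail_form n t)).

Lemma symm_kQ n : (1 <= n <= N)%N -> symm_mx (kQ k n).
Proof. by move=> /hQ[]. Qed.

Lemma symm_kR n : (1 <= n <= N)%N -> symm_mx (kR k n).
Proof. by move=> /hR[]. Qed.

Lemma symm_kf_pred n : (n < N)%N -> symm_mx (kf_pred k n.+1).2.
Proof. by move=> /(psd_kf_pred hP0 hQ hR)[]. Qed.

Lemma loss_from_pred_eq t n s :
  loss_from_pred (kk t) l N n s
  = lpred l n (s.1, s.2, Mf t n, yf t n)
    + loss_from_post (kk t) l N n
        (xup (kH k n) s.1 s.2 (Mf t n) (yf t n), Pup (kH k n) s.2 (Mf t n)).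
Proof. by []. Qed.

Lemma deriv_on_lpred n (a0 := ((kf_pred k n).1, (kf_pred k n).2, kR k n, ky k n))
    (E : 'cV[R]_(dx n) * 'M[R]_(dx n) * 'M[R]_(dy n) * 'cV[R]_(dy n) -> R^o :=
      fun d => form (dlpred_x k l n) d.1.1.1 + form (dlpred_P k l n) d.1.1.2
          + form (dlpred_R k l n) d.1.2 + form (dlpred_y k l n) d.2) :
  (1 <= n <= N)%N ->
  [/\ deriv_on (@predS n) (lpred l n : _ -> R^o) a0 E, norm_bounded E
    & forall a b, E (a - b) = E a - E b].
Proof.
move=> nN; split.
- by case: (is_gradient_lpred nN).
- do 3?[apply: norm_boundedD].
  + apply: norm_bounded_comp (form_bounded _).
    apply: norm_bounded_comp (norm_bounded_fst _ _).
    by apply: norm_bounded_comp (norm_bounded_fst _ _); exact: norm_bounded_fst.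
  + apply: norm_bounded_comp (form_bounded _).
    apply: norm_bounded_comp (norm_bounded_snd _ _).
    by apply: norm_bounded_comp (norm_bounded_fst _ _); exact: norm_bounded_fst.
  + apply: norm_bounded_comp (form_bounded _).
    by apply: norm_bounded_comp (norm_bounded_snd _ _); exact: norm_bounded_fst.
  + exact: norm_bounded_comp (norm_bounded_snd _ _) (form_bounded _).
- by move=> a b; rewrite /E !formB; ring.
Qed.

(** Chain rule through the update: [loss_from_pred] is [lpred] after [(x, P, R, y)] plus
    [loss_from_post] after the updated state paired with [t]. The adjoint formulas then regroup the
    coefficients. *)
Lemma pred_deriv n : (n < N)%N -> post_claim n.+1 ->
  deriv_on (stateS n.+1)
    ((fun v => loss_from_pred (kk v.2) l N n.+1 v.1) : _ -> R^o)
    (kf_pred k n.+1, th0)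
    (state_form (rec_xpred n.+1) (rec_Ppred n.+1)
      (fun t => form (rec_y n.+1) (Dy n.+1 t) + form (rec_R n.+1) (DM n.+1 t)
                + tail_form n.+1 t)).
Proof.
move=> nN; have nN1 : (1 <= n.+1 <= N)%N by [].
case=> _ [gPT _] dpost; rewrite /= in gPT.
have MT := symm_kR nN1; have uM := pd_unitmx (hR nN1).
have PT := symm_kf_pred nN.
have uS := psd_icov (kH k n.+1) (psd_kf_pred hP0 hQ hR nN) (hR nN1).
have M0 := affine_at_val (aM nN1); have y0 := affine_at_val (ay nN1).
set v0 := (kf_pred k n.+1, th0).
have [dx1 dP1 dt1] := deriv_on_state_proj v0.
have dM1 := deriv_on_theta (kf_pred k n.+1) (aM nN1).
have dy1 := deriv_on_theta (kf_pred k n.+1) (ay nN1).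
have dmap1 := deriv_on_pair (deriv_on_pair (deriv_on_pair dx1 dP1) dM1) dy1.
have [dl dlb dlB] := deriv_on_lpred nN1.
set E := (fun d => _) in dl dlb dlB.
have dA : deriv_on (stateS n.+1) ((fun v => lpred l n.+1
      (v.1.1, v.1.2, Mf v.2 n.+1, yf v.2 n.+1)) : _ -> R^o) v0
    (fun d => E (d.1.1, d.1.2, DM n.+1 d.2, Dy n.+1 d.2)).
  apply: (deriv_on_comp (T := @predS n.+1) (g := lpred l n.+1 : _ -> R^o)
    dlB dlb _ dmap1); first by rewrite [v0.2]/= M0 y0.
  move=> d [dPT dT]; split.
    by rewrite /= addrC addKr.
  by case: (aM nN1) => ME _ _; rewrite /= ME M0 addrC addKr; exact: DMT.
have uS1 : icov (kH k n.+1) v0.1.2 (Mf v0.2 n.+1) \in unitmx by rewrite [v0.2]/= M0.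
have MT1 : symm_mx (Mf v0.2 n.+1) by rewrite [v0.2]/= M0.
have dx2 := deriv_on_xup dx1 dP1 dM1 dy1 uS1.
have dP2 := deriv_on_Pup dP1 dM1 uS1 PT MT1.
have dmap2 := deriv_on_pair (deriv_on_pair dx2 dP2) dt1.
have dB := deriv_on_comp (T := stateS n.+1) (S := stateS n.+1)
  (g := (fun v => loss_from_post (kk v.2) l N n.+1 v.1) : _ -> R^o)
  (fun a b => state_formB (dL_xpost k l N n.+1) (dL_Ppost k l N n.+1) _ _
    (tail_formB n.+1))
  (state_form_bounded _ _ (tail_form_bounded n.+1)) _ dmap2.
apply: eq_deriv_on (deriv_onD dA (dB _ _)) => //.
- move=> d [dPT dT]; have DMd := DMT n.+1 dT.
  rewrite /E /state_form [v0.2]/= M0 y0.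
  rewrite form_dxup // form_dPup.
  rewrite /rec_xpred /rec_Ppred /rec_R /rec_y /A.
  rewrite -[K n.+1]/(kgain (kH k n.+1) (kf_pred k n.+1).2 (kR k n.+1)).
  rewrite -[z n.+1]/(ky k n.+1 - kH k n.+1 *m (kf_pred k n.+1).1).
  rewrite -[Y n.+1]/(invmx (icov (kH k n.+1) (kf_pred k n.+1).2 (kR k n.+1))).
  rewrite -![(_, th0).1]/(kf_pred k n.+1).
  set Kg := kgain _ _ _; set zg := ky k n.+1 - _; set Yg := invmx (icov _ _ _).
  set A1 := 1%:M - _; set gP := dL_Ppost _ _ _ _; set gx := dL_xpost _ _ _ _.
  rewrite -(addrA gP) -(addrA (Kg^T *m gP *m Kg)) -opprD.
  (* [W1] and [W2] are the symmetrized rank-one terms common to both sides; once opaque, only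
     bilinearity of [form] remains. *)
  set W1 := 2^-1 *: (gx *m _ *m _ *m _) + _; set W2 := 2^-1 *: _ + _.
  clearbody A1 Kg zg Yg gP gx W1 W2.
  by rewrite mulmxDr mulmxDl !(formDl, formNl) /=; ring.
- by rewrite [v0.2]/= M0 y0; exact: dpost.
- move=> d [dPT dT]; split; last by rewrite /= addrC addKr.
  apply: symm_mxB; apply: symm_Pup => //.
    exact: symm_mxD.
  case: (aM nN1) => ME _ _; rewrite /= ME; apply: symm_mxD => //; exact: DMT.
Qed.

Lemma loss_from_post_th0 n s : (n <= N)%N ->
  loss_from_post (kk th0) l N n s = loss_from_post k l N n s.
Proof.
move=> nN; rewrite /loss_from_post tail_loss_ext //= subnKC // => m /andP[nm mN].
have mN1 : (1 <= m <= N)%N by rewrite (leq_trans _ nm).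
by rewrite (affine_at_val (aQ mN1)) (affine_at_val (aM mN1))
  (affine_at_val (ay mN1)).
Qed.

Lemma loss_from_postE (k' : kalman R dx dy du) n s : (n < N)%N ->
  loss_from_post k' l N n s
  = lpost l n s + loss_from_pred k' l N n.+1 (kf_predict k' (n := n.+1) s).
Proof.
move=> nN; rewrite /loss_from_pred /loss_from_post -(subnSK nN) /=.
by congr (_ + _); rewrite addrA.
Qed.

Lemma tail_formE n t : (n < N)%N ->
  tail_form n t = step_form n.+1 t + tail_form n.+1 t.
Proof. by move=> nN; rewrite /tail_form big_ltn. Qed.

Lemma tail_form0 n : tail_form n 0 = 0.
Proof. by have := tail_formB n 0 0; rewrite !subrr. Qed.

(** Setting [t = th0] reads the partial gradients off any joint differential of the right shape;
    uniqueness then replaces its coefficients by [dL_xpost] and [dL_Ppost]. *)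
Lemma post_claim_intro n gx gP : (n <= N)%N -> symm_mx gP ->
  deriv_on (stateS n)
    ((fun v => loss_from_post (kk v.2) l N n v.1) : _ -> R^o)
    (kf_post k n, th0) (state_form gx gP (tail_form n)) ->
  [/\ is_gradient setT (L_xpost k l N n) (kf_post k n).1 gx,
      is_gradient symm_mx (L_Ppost k l N n) (kf_post k n).2 gP
    & post_claim n].
Proof.
move=> nN gPT dpost; have [] := state_gradient _ gPT dpost.
  exact: tail_form0.
rewrite [X in is_gradient setT X](_ : _ = L_xpost k l N n); last first.
  by apply/funext => x; exact: loss_from_post_th0.
rewrite [X in is_gradient symm_mx X](_ : _ = L_Ppost k l N n); last first.
  by apply/funext => x; exact: loss_from_post_th0.
move=> Gx GP; split => //; rewrite /post_claim /dL_xpost /dL_Ppost.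
by rewrite (gradient_unique_setT Gx) (gradient_unique_symm GP).
Qed.

Lemma post_pred_claim n : (n < N)%N -> post_claim n.+1 ->
  [/\ is_gradient setT (L_xpred k l N n.+1) (kf_pred k n.+1).1 (rec_xpred n.+1),
      is_gradient symm_mx (L_Ppred k l N n.+1) (kf_pred k n.+1).2 (rec_Ppred n.+1)
    & pred_claim n.+1].
Proof.
move=> nN cn; have nN1 : (1 <= n.+1 <= N)%N by [].
have dp := pred_deriv nN cn.
have gPT : symm_mx (rec_Ppred n.+1).
  have [_ gP _ _ _] := is_gradient_lpred nN1; have [_ [gpT _] _] := cn.
  have [lPT _] := gP.
  apply: symm_mxD => //; rewrite -{2}[A n.+1]trmxK; apply: symm_sandwich.
  rewrite -addrA; apply: symm_mxD => //.
  (* The two half terms are transposes of each other. *)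
  rewrite /symm_mx /= linearD !linearZ /= !trmx_mul !trmxK trmx_inv.
  by rewrite (symm_kR nN1) !mulmxA addrC.
have [] := state_gradient _ gPT dp.
  by rewrite (affine_at_D0 (aM nN1)) (affine_at_D0 (ay nN1)) !form0 tail_form0 !addr0.
have M0 := affine_at_val (aM nN1); have y0 := affine_at_val (ay nN1).
have lE s : loss_from_pred (kk th0) l N n.+1 s = loss_from_pred k l N n.+1 s.
  by rewrite loss_from_pred_eq loss_from_post_th0 // M0 y0.
rewrite [X in is_gradient setT X](_ : _ = L_xpred k l N n.+1); last first.
  by apply/funext => x; exact: lE.
rewrite [X in is_gradient symm_mx X](_ : _ = L_Ppred k l N n.+1); last first.
  by apply/funext => x; exact: lE.
move=> gx gP; split => //.
rewrite /pred_claim /dL_xpred /dL_Ppred.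
by rewrite (gradient_unique_setT gx) (gradient_unique_symm gP).
Qed.

Definition rec_xpost n := (kF k n.+1)^T *m dL_xpred k l N n.+1 + dlpost_x k l n.

Definition rec_Ppost n :=
  (kF k n.+1)^T *m dL_Ppred k l N n.+1 *m kF k n.+1 + dlpost_P k l n.

(** Chain rule through the prediction. It pairs [DQ] with [dL_Ppred], whereas [step_form] is written
    with [rec_Ppred]; the equality hypothesis reconciles them. *)
Lemma pred_post_claim n : (n < N)%N -> dL_Ppred k l N n.+1 = rec_Ppred n.+1 ->
  symm_mx (dL_Ppred k l N n.+1) -> pred_claim n.+1 ->
  [/\ is_gradient setT (L_xpost k l N n) (kf_post k n).1 (rec_xpost n),
      is_gradient symm_mx (L_Ppost k l N n) (kf_post k n).2 (rec_Ppost n)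
    & post_claim n].
Proof.
move=> nN EP dPT dpred; have nN1 : (1 <= n.+1 <= N)%N by [].
have [lx lP dl] := is_gradient_lpost (ltnW nN).
set v0 := (kf_post k n, th0).
have [dx1 dP1 dt1] := deriv_on_state_proj v0.
have dQ1 := deriv_on_theta (kf_post k n) (aQ nN1).
have dmap := deriv_on_pair (deriv_on_pair
  (deriv_onD (deriv_on_mull (kF k n.+1) dx1)
             (deriv_on_cst (stateS n) (kB k n.+1 *m ku k n.+1) v0))
  (deriv_onD (deriv_on_mulr (kF k n.+1)^T (deriv_on_mull (kF k n.+1) dP1)) dQ1))
  dt1.
have Q0 := affine_at_val (aQ nN1).
pose h t : R^o := form (rec_y n.+1) (Dy n.+1 t) + form (rec_R n.+1) (DM n.+1 t)
                + tail_form n.+1 t.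
have hB a b : h (a - b) = h a - h b.
  case: (aM nN1) (ay nN1) => _ MB _ [_ yB _].
  by rewrite /h MB yB !formB tail_formB; ring.
have hb : norm_bounded h.
  case: (aM nN1) (ay nN1) => _ _ Mb [_ _ yb].
  by apply: norm_boundedD; [apply: norm_boundedD|exact: tail_form_bounded];
    apply: norm_bounded_comp (form_bounded _).
have dA := deriv_on_comp (T := stateS n.+1) (S := stateS n)
  (g := (fun v => loss_from_pred (kk v.2) l N n.+1 v.1) : _ -> R^o)
  (fun a b => state_formB (dL_xpred k l N n.+1) (dL_Ppred k l N n.+1) _ _ hB)
  (state_form_bounded _ _ hb) _ dmap.
have dB : deriv_on (stateS n) ((fun v => lpost l n v.1) : _ -> R^o) v0
    (fun d => form (dlpost_x k l n) d.1.1 + form (dlpost_P k l n) d.1.2).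
  have -> : v0 = (((kf_post k n).1, (kf_post k n).2), th0).
    by rewrite /v0; case: (kf_post k n).
  apply: (deriv_on_pullback (i := fst) (i0 := fst) _ _ _ dl) => //= d.
  - exact: norm_fst_le.
  - by case.
apply: post_claim_intro; first exact: ltnW.
  by apply: symm_mxD; [rewrite -{2}[kF k n.+1]trmxK; exact: symm_sandwich|case: lP].
apply: eq_deriv_on (deriv_onD dB (dA _ _)) => //.
- by move=> d _; rewrite loss_from_postE.
- by rewrite [in RHS]loss_from_postE.
- move=> d _; rewrite /state_form /h (tail_formE _ nN) /step_form /rec_xpost /rec_Ppost.
  rewrite -EP addr0 !formDr !formDl form_mull form_sandwich trmxK; ring.
- by rewrite [v0.2]/= Q0; exact: dpred.
- move=> d [dPT' dT]; split; last by rewrite /= addrC addKr.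
  have PT : symm_mx (kf_post k n).2 by case: (psd_kf_post hP0 hQ hR (ltnW nN)).
  case: (aQ nN1) => QE _ _; apply: symm_mxB => /=; apply: symm_mxD.
  + exact/symm_sandwich/symm_mxD.
  + by rewrite QE; apply: symm_mxD; [exact: symm_kQ|exact: DQT].
  + exact: symm_sandwich.
  + by rewrite Q0; exact: symm_kQ.
Qed.

Lemma post_claim_last :
  [/\ is_gradient setT (L_xpost k l N N) (kf_post k N).1 (dlpost_x k l N),
      is_gradient symm_mx (L_Ppost k l N N) (kf_post k N).2 (dlpost_P k l N)
    & post_claim N].
Proof.
have [lx lP dl] := is_gradient_lpost (leqnn N).
apply: post_claim_intro => //; first by case: lP.
have -> : (kf_post k N, th0) = ((kf_post k N).1, (kf_post k N).2, th0).
  by case: (kf_post k N).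
have df : deriv_on (stateS N) ((fun v => lpost l N v.1) : _ -> R^o)
    ((kf_post k N).1, (kf_post k N).2, th0)
    (fun d => form (dlpost_x k l N) d.1.1 + form (dlpost_P k l N) d.1.2).
  apply: (deriv_on_pullback (i := fst) (i0 := fst) _ _ _ dl) => // d.
  - exact: norm_fst_le.
  - by case.
apply: eq_deriv_on df => [d _||d _].
- by rewrite /loss_from_post subnn /= addr0.
- by rewrite /loss_from_post subnn /= addr0.
- by rewrite /state_form /tail_form big_geq // addr0.
Qed.

Lemma post_claim_all n : (n <= N)%N -> post_claim n.
Proof.
(* Backward induction, run on the number [N - n] of remaining steps. *)
move=> nN; rewrite -(subKn nN); have := leq_subr n N.
elim: (N - n)%N => [_|j IHj jN].
  by rewrite subn0; case: post_claim_last.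
have jN' : (N - j.+1 < N)%N by rewrite ltn_subrL; case: (N) jN.
have := IHj (ltnW jN); rewrite -(subnSK jN) => cn.
have [_ gP dp] := post_pred_claim jN' cn.
have EP := gradient_unique_symm gP.
have [] := pred_post_claim jN' EP _ dp; last by [].
by rewrite -[dL_Ppred _ _ _ _]/(gradient _ _ _) EP; case: gP.
Qed.

Hypothesis hl0 : forall s, lpost l 0 s = 0.

(** The initial state does not depend on [t] and step 0 carries no loss, so the total loss is
    [loss_from_post] at a fixed state. A zero state increment leaves only [tail_form 0]. *)
Lemma deriv_on_loss :
  deriv_on ST ((fun t => loss (kk t) l N) : _ -> R^o) th0 (tail_form 0).
Proof.
have [_ _ dp] := post_claim_all (leq0n N).
have lE t : loss (kk t) l N = loss_from_post (kk t) l N 0 (kf_post k 0).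
  by rewrite loss_tail /loss_from_post hl0 add0r subn0.
have di : deriv_on ST ((fun t => loss_from_post (kk t) l N 0 (kf_post k 0))
    : _ -> R^o) th0 (fun t => state_form (dL_xpost k l N 0) (dL_Ppost k l N 0)
      (tail_form 0) (0, 0, t)).
  apply: (deriv_on_pullback (i := fun t => (kf_post k 0, t))
    (i0 := fun t => (0, t)) _ _ _ dp) => // d.
  - by congr pair; rewrite addr0.
  - exact: norm_pair0r.
  - by move=> dT; split => //; exact: trmx0.
apply: eq_deriv_on di => [d _||d _]; [exact/esym/lE|exact/esym/lE|].
by rewrite /state_form /= !form0 !add0r.
Qed.

End Theta.

Lemma affine_at_cst (Th W : normedModType R) (t : Th) (w : W) :
  affine_at (fun=> w) t w (fun=> 0).
Proof.
by split=> [d|a b|]; rewrite ?addr0 ?subr0 //; exact: norm_bounded0.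
Qed.

(** Instance of the parametrized induction with all data constant in a dummy real parameter. *)
Lemma state_recursion :
  [/\ forall n, (n <= N)%N ->
        is_gradient setT (L_xpost k l N n) (kf_post k n).1 (dL_xpost k l N n) /\
        is_gradient symm_mx (L_Ppost k l N n) (kf_post k n).2 (dL_Ppost k l N n),
      dL_xpost k l N N = dlpost_x k l N, dL_Ppost k l N N = dlpost_P k l N
    & forall n, (n < N)%N ->
      [/\ is_gradient setT (L_xpred k l N n.+1) (kf_pred k n.+1).1 (rec_xpred n.+1),
          is_gradient symm_mx (L_Ppred k l N n.+1) (kf_pred k n.+1).2
            (rec_Ppred n.+1),
          dL_xpost k l N n = rec_xpost n & dL_Ppost k l N n = rec_Ppost n]].
Proof.
have aQ n : (1 <= n <= N)%N -> affine_at (fun=> kQ k n) (0 : R^o) (kQ k n) (fun=> 0).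
  by move=> _; exact: affine_at_cst.
have aM n : (1 <= n <= N)%N -> affine_at (fun=> kR k n) (0 : R^o) (kR k n) (fun=> 0).
  by move=> _; exact: affine_at_cst.
have ay n : (1 <= n <= N)%N -> affine_at (fun=> ky k n) (0 : R^o) (ky k n) (fun=> 0).
  by move=> _; exact: affine_at_cst.
have T0 d (t : R^o) : setT t -> symm_mx (0 : 'M[R]_d) by move=> _; exact: trmx0.
have cl n (nN : (n <= N)%N) :=
  post_claim_all (ST := [set: R^o]) I aQ aM ay (fun n => @T0 _) (fun n => @T0 _) nN.
have [lx lP _] :=
  post_claim_last (ST := [set: R^o]) I aQ aM ay.
split.
- by move=> n nN; have [] := cl _ nN.
- exact: gradient_unique_setT lx.
- exact: gradient_unique_symm lP.
move=> n nN.
have [gx gP dp] := post_pred_claim (ST := [set: R^o]) I aQ aM ay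
  (fun n => @T0 _) nN (cl _ nN).
have EP := gradient_unique_symm gP.
have [] := pred_post_claim (ST := [set: R^o]) I aQ aM ay
  (fun n => @T0 _) nN EP _ dp.
  by rewrite -[dL_Ppred _ _ _ _]/(gradient _ _ _) EP; case: gP.
move=> /gradient_unique_setT Ex /gradient_unique_symm EP' _.
by split.
Qed.

Lemma symm_dL_Ppost n : (n <= N)%N -> symm_mx (dL_Ppost k l N n).
Proof. by move=> nN; have [/(_ _ nN)[_ []]] := state_recursion. Qed.

Lemma symm_rec_R n : (1 <= n <= N)%N -> symm_mx (rec_R n).
Proof.
move=> nN; have [_ _ [lRT _] _ _] := is_gradient_lpred nN.
have gPT : symm_mx (dL_Ppost k l N n) by apply: symm_dL_Ppost; case/andP: nN.
have ST : (Y n)^T = Y n.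
  rewrite trmx_inv; congr invmx.
  case: n nN {lRT gPT} => // n nN; apply: trmx_icov; last exact: symm_kR.
  exact: symm_kf_pred.
apply: symm_mxD => //; rewrite -addrA -opprD; apply: symm_mxB.
  by rewrite -{2}[K n]trmxK; exact: symm_sandwich.
rewrite /symm_mx /= linearD !linearZ /= !trmx_mul !trmxK ST.
by rewrite !mulmxA addrC.
Qed.

Lemma symm_rec_Ppred n : (1 <= n <= N)%N -> symm_mx (rec_Ppred n).
Proof. by case: n => // n nN; have [_ _ _ /(_ _ nN)[_ []]] := state_recursion. Qed.

End Param.

(** * Affine families: one overridden entry, or a common value for all steps *)

Section FamilyParam.
Variable R : realType.

(** The linear part of overriding the entry [n] of a family. *)
Definition single (a b : nat -> nat) n (d : 'M[R]_(a n, b n)) m : 'M[R]_(a m, b m) :=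
  eqtype.dfwith (T := fun n => 'M[R]_(a n, b n)) (fun=> 0) d m.

Lemma affine_at_dfwith (a b : nat -> nat) (f : forall n, 'M[R]_(a n, b n)) n m :
  affine_at (fun v => eqtype.dfwith f v m) (f n) (f m)
    (fun d => single d m).
Proof.
have [<-|nm] := eqVneq n m.
  rewrite /single; split=> [d|c d|]; rewrite ?dfwith_in //.
  by exists 1 => d; rewrite dfwith_in mul1r.
rewrite /single; split=> [d|c d|]; rewrite ?dfwith_out ?addr0 ?subr0 //.
by exists 0 => d; rewrite dfwith_out // normr0 mul0r.
Qed.

Lemma castmxD m n m' n' (e : (m = m') * (n = n')) (A B : 'M[R]_(m, n)) :
  castmx e (A + B) = castmx e A + castmx e B.
Proof. by apply/matrixP => i j; rewrite !(castmxE, mxE). Qed.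

Lemma castmxB m n m' n' (e : (m = m') * (n = n')) (A B : 'M[R]_(m, n)) :
  castmx e (A - B) = castmx e A - castmx e B.
Proof. by apply/matrixP => i j; rewrite !(castmxE, mxE). Qed.

Lemma norm_bounded_castmx m n m' n' (e : (m = m') * (n = n')) :
  norm_bounded (@castmx R m n m' n' e).
Proof.
exists 1 => A; rewrite mul1r; apply: mx_norm_le => // i j.
by rewrite castmxE entry_le_mx_norm.
Qed.

Lemma form_castmx m n m' n' (e : m = m') (e' : n = n') (G : 'M[R]_(m, n)) d :
  form G (castmx (esym e, esym e') d) = form (castmx (e, e') G) d.
Proof. by case: m' / e d; case: n' / e' => d; rewrite !castmx_id. Qed.

Lemma symm_castmx m m' (e : m = m') (A : 'M[R]_m) :
  symm_mx A -> symm_mx (castmx (e, e) A).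
Proof. by case: m' / e; rewrite castmx_id. Qed.

Lemma affine_at_const_mx_family (d : nat -> nat) m (e : forall n, d n = m)
    (C : 'M[R]_m) n (B : 'M[R]_(d n)) : B = const_mx_family e C n ->
  affine_at (fun A => const_mx_family e A n) C B
    (fun D => const_mx_family e D n).
Proof.
move=> ->; split=> [D|a b|]; first exact: castmxD.
- exact: castmxB.
- exact: norm_bounded_castmx.
Qed.

Lemma symm_const_mx_family (d : nat -> nat) m (e : forall n, d n = m) n
    (A : 'M[R]_m) : symm_mx A -> symm_mx (const_mx_family e A n).
Proof. exact: symm_castmx. Qed.

Lemma form_suml (I : Type) (r : seq I) m n (G : I -> 'M[R]_(m, n)) d :
  form (\sum_(i <- r) G i) d = \sum_(i <- r) form (G i) d.
Proof.
elim/big_rec2: _ => [|i x y _ <-]; last by rewrite formDl.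
by rewrite /form linear0 mul0mx mxtrace0.
Qed.

Lemma sum_form_dfwith (a b : nat -> nat) N (G : forall m, 'M[R]_(a m, b m)) n
    (d : 'M[R]_(a n, b n)) : (1 <= n <= N)%N ->
  \sum_(1 <= m < N.+1) form (G m) (single d m) = form (G n) d.
Proof.
move=> nN; rewrite (bigD1_seq n) /= ?mem_index_iota ?iota_uniq //.
rewrite /single dfwith_in big1 ?addr0 // => m mn.
by rewrite dfwith_out 1?eq_sym // form0.
Qed.

Lemma symm_sum (I : Type) (r : seq I) (P : pred I) n (G : I -> 'M[R]_n) :
  (forall i, P i -> symm_mx (G i)) -> symm_mx (\sum_(i <- r | P i) G i).
Proof.
move=> GT; apply: (big_ind (@symm_mx R n)) => //; first exact: trmx0.
exact: symm_mxD.
Qed.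

End FamilyParam.

(** Covers the posterior loss of step 0, which is zero by convention. *)
Lemma differentiable_in_cst (R : realType) (V : normedModType R) (S : set V)
    (f : V -> R) c v : (forall w, f w = c) -> differentiable_in S f v.
Proof.
move=> fc; pose L : {linear V -> R^o} := \0.
exists L; split=> [x|e e0]; first exact: cst_continuous.
by apply: nearW => d _; rewrite !fc subrr subr0 normr0 mulr_ge0 // ltW.
Qed.

(** * Gradients with respect to measurements and noise parameters *)

Section ParameterGradients.
Variables (R : realType) (dx dy du : nat -> nat) (N : nat).
Variables (k : kalman R dx dy du) (l : kalman_loss R dx dy).
Hypotheses (hP0 : psd_mx (kP0 k))
  (hQ : forall n, (1 <= n <= N)%N -> psd_mx (kQ k n))
  (hR : forall n, (1 <= n <= N)%N -> pd_mx (kR k n)).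
Hypotheses (hlpred : forall n, (1 <= n <= N)%N ->
    differentiable_in [set a : 'cV[R]_(dx n) * 'M[R]_(dx n) * 'M[R]_(dy n)
      * 'cV[R]_(dy n) | symm_mx a.1.1.2 /\ symm_mx a.1.2] (lpred l n)
      ((kf_pred k n).1, (kf_pred k n).2, kR k n, ky k n))
  (hlpost : forall n, (n <= N)%N ->
    differentiable_in [set a : 'cV[R]_(dx n) * 'M[R]_(dx n) | symm_mx a.2]
      (lpost l n) (kf_post k n))
  (hl0 : forall s, lpost l 0 s = 0).

Let aQ (Th : normedModType R) (t : Th) n : (1 <= n <= N)%N ->
  affine_at (fun=> kQ k n) t (kQ k n) (fun=> 0).
Proof. by move=> _; exact: affine_at_cst. Qed.

Let aM (Th : normedModType R) (t : Th) n : (1 <= n <= N)%N ->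
  affine_at (fun=> kR k n) t (kR k n) (fun=> 0).
Proof. by move=> _; exact: affine_at_cst. Qed.

Let ay (Th : normedModType R) (t : Th) n : (1 <= n <= N)%N ->
  affine_at (fun=> ky k n) t (ky k n) (fun=> 0).
Proof. by move=> _; exact: affine_at_cst. Qed.

Let symm0 (Th : Type) (S : set Th) (d : nat -> nat) n (t : Th) :
  S t -> symm_mx (0 : 'M[R]_(d n)).
Proof. by move=> _; exact: trmx0. Qed.

Let symm_single (d : nat -> nat) m n (A : 'M[R]_(d m)) :
  symm_mx A -> symm_mx (single (a := d) (b := d) A n).
Proof.
move=> AT; rewrite /single; have [<-|nm] := eqVneq m n; first by rewrite dfwith_in.
by rewrite dfwith_out //; exact: trmx0.
Qed.

(** Here [t] is [y_n] itself: its increment is supported at step [n], so the sum [tail_form 0]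
    collapses to a single term. *)
Lemma is_gradient_L_y n : (1 <= n <= N)%N ->
  is_gradient setT (L_y k l N n) (ky k n) (rec_y N k l n).
Proof.
move=> nN; apply/is_gradientP; split => //.
have := deriv_on_loss (ST := setT) hP0 hQ hR hlpred hlpost I (@aQ _ (ky k n))
  (@aM _ (ky k n)) (fun m _ => affine_at_dfwith (ky k) n m)
  (@symm0 _ setT dx) (@symm0 _ setT dy) hl0.
apply: eq_deriv_on => // d _; rewrite -(sum_form_dfwith (rec_y N k l) d nN).
by apply: eq_bigr => m _; rewrite /step_form !form0 !addr0.
Qed.

Lemma is_gradient_L_Q n : (1 <= n <= N)%N ->
  is_gradient symm_mx (L_Q k l N n) (kQ k n) (rec_Ppred N k l n).
Proof.
move=> nN; apply/is_gradientP.
split; first exact: symm_rec_Ppred hP0 hQ hR hlpred hlpost _ nN.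
have := deriv_on_loss (ST := symm_mx) hP0 hQ hR hlpred hlpost (trmx0 _ _ _)
  (fun m _ => affine_at_dfwith (kQ k) n m) (@aM _ (kQ k n))
  (@ay _ (kQ k n)) (fun m d => @symm_single dx n m d) (@symm0 _ symm_mx dy) hl0.
apply: eq_deriv_on => // d _; rewrite -(sum_form_dfwith (rec_Ppred N k l) d nN).
by apply: eq_bigr => m _; rewrite /step_form !form0 addr0 add0r.
Qed.

Lemma is_gradient_L_R n : (1 <= n <= N)%N ->
  is_gradient symm_mx (L_R k l N n) (kR k n) (rec_R N k l n).
Proof.
move=> nN; apply/is_gradientP.
split; first exact: symm_rec_R hP0 hQ hR hlpred hlpost _ nN.
have := deriv_on_loss (ST := symm_mx) hP0 hQ hR hlpred hlpost (trmx0 _ _ _)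
  (@aQ _ (kR k n)) (fun m _ => affine_at_dfwith (kR k) n m)
  (@ay _ (kR k n)) (@symm0 _ symm_mx dx) (fun m d => @symm_single dy n m d) hl0.
apply: eq_deriv_on => // d _; rewrite -(sum_form_dfwith (rec_R N k l) d nN).
by apply: eq_bigr => m _; rewrite /step_form !form0 !add0r.
Qed.

(** The differential of [M *m M^T] is [d L^T + L d^T]; these transposes pair equally with the
    symmetric gradient, whence the factor 2. Values [M *m M^T] are always symmetric, so the
    symmetric derivative of [L_R] suffices. *)
Lemma is_gradient_L_sqrt n p (L : 'M[R]_(dy n, p)) : (1 <= n <= N)%N ->
  kR k n = L *m L^T ->
  is_gradient setT (fun M : 'M[R]_(dy n, p) => L_R k l N n (M *m M^T)) L
    (2 *: (rec_R N k l n *m L)).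
Proof.
move=> nN RL; apply/is_gradientP; split => //.
have /is_gradientP[GT dG] := is_gradient_L_R nN; rewrite RL in dG.
have dL : deriv_on setT (fun M : 'M[R]_(dy n, p) => M) L id.
  by apply: deriv_on_affine => //; exists 1 => d; rewrite mul1r.
have dLT : deriv_on setT (fun M : 'M[R]_(dy n, p) => M^T) L trmx.
  apply: deriv_on_affine => [d|]; first by rewrite linearD.
  by exists 1 => d; rewrite mul1r mx_norm_trmx.
have := deriv_on_comp (f := fun M : 'M[R]_(dy n, p) => M *m M^T)
  (formB _) (form_bounded _) dG (deriv_on_mulmx dL dLT).
have symmLL (B : 'M[R]_(dy n, p)) : symm_mx (B *m B^T).
  by rewrite /symm_mx /= trmx_mul trmxK.
move=> /(_ (fun d _ => symm_mxB (symmLL _) (symmLL _))).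
apply: eq_deriv_on => // d _.
have -> : form (rec_R N k l n) (d *m L^T + L *m d^T)
    = 2 * form (rec_R N k l n) (d *m L^T).
  have swap : form (rec_R N k l n) (L *m d^T) = form (rec_R N k l n) (d *m L^T).
    by rewrite /form -[LHS]mxtrace_tr !trmx_mul !trmxK mxtrace_mulC GT.
  by rewrite formDr swap mulrDl mul1r.
rewrite /form linearZ /= -scalemxAl mxtraceZ trmx_mul; congr (_ * _).
by rewrite mulmxA mxtrace_mulC mulmxA.
Qed.

(** A common increment reaches every step, so all terms of [tail_form 0] survive and their
    coefficients add up; [castmx] brings them to one size. *)
Lemma is_gradient_L_static_R m (e : forall n, dy n = m) (C : 'M[R]_m) :
  (forall n, (1 <= n <= N)%N -> kR k n = const_mx_family e C n) ->
  is_gradient symm_mx (fun M : 'M[R]_m => loss (set_R k (const_mx_family e M)) l N)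
    C (\sum_(1 <= n < N.+1) castmx (e n, e n) (rec_R N k l n)).
Proof.
move=> RC; apply/is_gradientP; split.
  rewrite big_nat; apply: symm_sum => n nN; apply: symm_castmx.
  exact: symm_rec_R hP0 hQ hR hlpred hlpost _ nN.
have := deriv_on_loss (ST := symm_mx) hP0 hQ hR hlpred hlpost (trmx0 _ _ _)
  (@aQ _ C) (fun n nN => affine_at_const_mx_family (RC n nN))
  (@ay _ C) (@symm0 _ symm_mx dx) (@symm_const_mx_family _ _ _ e) hl0.
apply: eq_deriv_on => // d _; rewrite form_suml.
by apply: eq_bigr => n _; rewrite /step_form !form0 !add0r form_castmx.
Qed.

Lemma is_gradient_L_static_Q m (e : forall n, dx n = m) (C : 'M[R]_m) :
  (forall n, (1 <= n <= N)%N -> kQ k n = const_mx_family e C n) ->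
  is_gradient symm_mx (fun M : 'M[R]_m => loss (set_Q k (const_mx_family e M)) l N)
    C (\sum_(1 <= n < N.+1) castmx (e n, e n) (rec_Ppred N k l n)).
Proof.
move=> QC; apply/is_gradientP; split.
  rewrite big_nat; apply: symm_sum => n nN; apply: symm_castmx.
  exact: symm_rec_Ppred hP0 hQ hR hlpred hlpost _ nN.
have := deriv_on_loss (ST := symm_mx) hP0 hQ hR hlpred hlpost (trmx0 _ _ _)
  (fun n nN => affine_at_const_mx_family (QC n nN)) (@aM _ C)
  (@ay _ C) (@symm_const_mx_family _ _ _ e) (@symm0 _ symm_mx dy) hl0.
apply: eq_deriv_on => // d _; rewrite form_suml.
by apply: eq_bigr => n _; rewrite /step_form !form0 add0r addr0 form_castmx.
Qed.

End ParameterGradients.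

Theorem theorem1 (R : realType) (dx dy du : nat -> nat) (N : nat)
  (k : kalman R dx dy du) (l : kalman_loss R dx dy)
  (hN : (1 <= N)%N)
  (hP0 : psd_mx (kP0 k))
  (hQ : forall n, (1 <= n <= N)%N -> psd_mx (kQ k n))
  (hR : forall n, (1 <= n <= N)%N -> pd_mx (kR k n))
  (hlpred : forall n, (1 <= n <= N)%N ->
    let S := [set a : 'cV[R]_(dx n) * 'M[R]_(dx n) * 'M[R]_(dy n)
                      * 'cV[R]_(dy n) | symm_mx a.1.1.2 /\ symm_mx a.1.2] in
    \forall a \near ((kf_pred k n).1, (kf_pred k n).2, kR k n, ky k n),
      S a -> differentiable_in S (lpred l n) a)
  (hlpost : forall n, (1 <= n <= N)%N ->
    let S := [set a : 'cV[R]_(dx n) * 'M[R]_(dx n) | symm_mx a.2] in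
    \forall a \near kf_post k n,
      S a -> differentiable_in S (lpost l n) a)
  (hl0 : forall s, lpost l 0 s = 0) :
  let I n : 'M[R]_(dx n) := 1%:M in
  let z n := innovation k (kf_pred k n) in
  let S n := innovation_cov k (kf_pred k n) in
  let K n := gain k (kf_pred k n) in
  [/\ (* the derivatives exist *)
      (forall n, (n <= N)%N ->
        has_gradient setT (L_xpost k l N n) (kf_post k n).1 /\
        has_gradient symm_mx (L_Ppost k l N n) (kf_post k n).2) /\
      (forall n, (1 <= n <= N)%N ->
        [/\ has_gradient setT (L_xpred k l N n) (kf_pred k n).1,
            has_gradient symm_mx (L_Ppred k l N n) (kf_pred k n).2,
            has_gradient setT (L_y k l N n) (ky k n),
            has_gradient symm_mx (L_Q k l N n) (kQ k n) &
            has_gradient symm_mx (L_R k l N n) (kR k n)]),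
      (* initialization *)
      dL_xpost k l N N = dlpost_x k l N /\ dL_Ppost k l N N = dlpost_P k l N,
      (* state variable equations *)
      forall n, (1 <= n <= N)%N ->
        [/\ dL_xpred k l N n
            = (I n - K n *m kH k n)^T *m dL_xpost k l N n + dlpred_x k l n,
            dL_Ppred k l N n
            = (I n - K n *m kH k n)^T
                *m (dL_Ppost k l N n
                    + 2^-1 *: (dL_xpost k l N n *m (z n)^T
                               *m invmx (kR k n) *m kH k n)
                    + 2^-1 *: ((kH k n)^T *m invmx (kR k n) *m z n
                               *m (dL_xpost k l N n)^T))
                *m (I n - K n *m kH k n)
              + dlpred_P k l n,
            dL_xpost k l N n.-1
            = (kF k n)^T *m dL_xpred k l N n + dlpost_x k l n.-1 &
            dL_Ppost k l N n.-1
            = (kF k n)^T *m dL_Ppred k l N n *m kF k n + dlpost_P k l n.-1],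
      (* parameter equations *)
      forall n, (1 <= n <= N)%N ->
        [/\ dL_y k l N n = (K n)^T *m dL_xpost k l N n + dlpred_y k l n,
            dL_Q k l N n = dL_Ppred k l N n,
            dL_R k l N n
            = (K n)^T *m dL_Ppost k l N n *m K n
              - 2^-1 *: ((K n)^T *m dL_xpost k l N n *m (z n)^T
                         *m invmx (S n))
              - 2^-1 *: (invmx (S n) *m z n *m (dL_xpost k l N n)^T *m K n)
              + dlpred_R k l n &
            (* square-root parametrization *)
            forall (p : nat) (Ln : 'M[R]_(dy n, p)), kR k n = Ln *m Ln^T ->
              let L_L := fun M : 'M[R]_(dy n, p) =>
                L_R k l N n (M *m M^T) in
              has_gradient setT L_L Ln /\
              gradient setT L_L Ln = 2 *: (dL_R k l N n *m Ln)] &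
      (* static noise parameters *)
      (forall (m : nat) (e : forall n, dy n = m) (Rc : 'M[R]_m),
        (forall n, (1 <= n <= N)%N -> kR k n = const_mx_family e Rc n) ->
        let L_Rc := fun M : 'M[R]_m =>
          loss (set_R k (const_mx_family e M)) l N in
        has_gradient symm_mx L_Rc Rc /\
        gradient symm_mx L_Rc Rc
        = \sum_(1 <= n < N.+1) castmx (e n, e n) (dL_R k l N n)) /\
      (forall (m : nat) (e : forall n, dx n = m) (Qc : 'M[R]_m),
        (forall n, (1 <= n <= N)%N -> kQ k n = const_mx_family e Qc n) ->
        let L_Qc := fun M : 'M[R]_m =>
          loss (set_Q k (const_mx_family e M)) l N in
        has_gradient symm_mx L_Qc Qc /\
        gradient symm_mx L_Qc Qc
        = \sum_(1 <= n < N.+1) castmx (e n, e n) (dL_Q k l N n))].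
Proof.
move=> I z S K.
have hlpred' n (nN : (1 <= n <= N)%N) : differentiable_in
    [set a : 'cV[R]_(dx n) * 'M[R]_(dx n) * 'M[R]_(dy n) * 'cV[R]_(dy n) |
      symm_mx a.1.1.2 /\ symm_mx a.1.2] (lpred l n)
    ((kf_pred k n).1, (kf_pred k n).2, kR k n, ky k n).
  (* Taken at the centre of the neighbourhood, which is admissible because the filter covariance and
     [R_n] are symmetric. *)
  have /= /nbhs_singleton := hlpred n nN; apply.
  split; last by case: (hR n nN).
  by case: n nN => // n nN; case: (psd_kf_pred hP0 hQ hR nN).
have hlpost' n (nN : (n <= N)%N) : differentiable_in
    [set a : 'cV[R]_(dx n) * 'M[R]_(dx n) | symm_mx a.2]
    (lpost l n) (kf_post k n).
  (* Step 0 is outside the range of [hlpost]; its loss is constantly zero. *)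
  case: n nN => [_|n nN]; first exact: differentiable_in_cst hl0.
  have /= /nbhs_singleton := hlpost n.+1 nN; apply.
  by case: (psd_kf_post hP0 hQ hR nN).
have [Gpost ExN EPN rec] := state_recursion hP0 hQ hR hlpred' hlpost'.
have Gy n nN := is_gradient_L_y hP0 hQ hR hlpred' hlpost' hl0 (n := n) nN.
have GQ n nN := is_gradient_L_Q hP0 hQ hR hlpred' hlpost' hl0 (n := n) nN.
have GR n nN := is_gradient_L_R hP0 hQ hR hlpred' hlpost' hl0 (n := n) nN.
have EQ n nN := gradient_unique_symm (GQ n nN).
have ER n nN := gradient_unique_symm (GR n nN).
have Epred n : (1 <= n <= N)%N ->
    dL_xpred k l N n = rec_xpred N k l n /\ dL_Ppred k l N n = rec_Ppred N k l n.
  case: n => // n nN; have [gx gP _ _] := rec n nN.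
  by split; [exact: gradient_unique_setT gx | exact: gradient_unique_symm gP].
split.
- split=> n nN.
    by have [gx gP] := Gpost n nN; split; eexists; [exact: gx|exact: gP].
  split; [| |by eexists; exact: Gy|by eexists; exact: GQ|by eexists; exact: GR].
    by case: n nN => // n nN; have [gx _ _ _] := rec n nN; eexists; exact: gx.
  by case: n nN => // n nN; have [_ gP _ _] := rec n nN; eexists; exact: gP.
- by [].
- case=> // n nN; have [Ex EP] := Epred n.+1 nN.
  by have [_ _ Ex' EP'] := rec n nN; split.
- move=> n nN; have [_ EP] := Epred n nN; split.
  + exact: gradient_unique_setT (Gy n nN).
  + by rewrite EP; exact: EQ.
  + exact: ER.
  + move=> p Ln RL L_L.
    have GL := is_gradient_L_sqrt hP0 hQ hR hlpred' hlpost' hl0 nN RL.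
    split; first by eexists; exact: GL.
    by rewrite [dL_R _ _ _ _]ER //; exact: gradient_unique_setT GL.
- split=> m e C hC L_C.
    have GC := is_gradient_L_static_R hP0 hQ hR hlpred' hlpost' hl0 hC.
    split; first by eexists; exact: GC.
    rewrite [LHS](gradient_unique_symm GC) big_nat [RHS]big_nat.
    by apply: eq_bigr => n nN; rewrite [dL_R _ _ _ _]ER.
  have GC := is_gradient_L_static_Q hP0 hQ hR hlpred' hlpost' hl0 hC.
  split; first by eexists; exact: GC.
  rewrite [LHS](gradient_unique_symm GC) big_nat [RHS]big_nat.
  by apply: eq_bigr => n nN; rewrite [dL_Q _ _ _ _]EQ.
Qed.
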